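(* Let $p$ be a prime and let $\pi$ be a twist-minimal unitary principal series representation of $GL(2,\mathbb Q_p)$ of conductor $p^2$. Then the newvector $W_\circ$ in the Whittaker model of $\pi$ satisfies $$\max_{g\in GL(2,\mathbb Q_p)}|W_\circ(g)|=p^{1/2}\,|W_\circ(\mathbf e)| ,$$ where $\mathbf e$ is the identity matrix.
   Context: A principal series representation $\chi_1\boxplus\chi_2$ of $GL(2,\mathbb Q_p)$ is twist-minimal if (up to ordering) $\chi_1$ is an unramified character of $\mathbb Q_p^\times$. The Whittaker model is taken with respect to an unramified additive character $\psi$ of $\mathbb Q_p$ (trivial on $\mathbb Z_p$ but not on $p^{-1}\mathbb Z_p$), i.e. $W(\begin{pmatrix}1&x\\0&1\end{pmatrix}g)=\psi(x)W(g)$. For $\pi$ of conductor $p^r$ with central character $\omega_\pi$, the newvector $W_\circ$ is the nonzero vector (unique up to scalar) satisfying $W_\circ(gk)=\omega_\pi(\delta)W_\circ(g)$ for all $k=\begin{pmatrix}\alpha&\beta\\\gamma&\delta\end{pmatrix}\in GL(2,\mathbb Z_p)$ with $p^r\mid\gamma$, where for unramified $\omega_\pi$ and $r=0$ this means right invariance under $GL(2,\mathbb Z_p)$. *)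

(* Defs.v *)
From HB Require Import structures.
From mathcomp Require Import all_boot all_order all_algebra.
From mathcomp Require Import fraction complex.
From mathcomp Require Import boolp classical_sets functions reals.

Set Implicit Arguments.
Unset Strict Implicit.
Unset Printing Implicit Defensive.

Import Order.TTheory GRing.Theory Num.Theory.

Local Open Scope ring_scope.
Local Open Scope classical_set_scope.
Local Open Scope complex_scope.

(* Z_p is the inverse limit of the rings Z/p^n: a p-adic integer is the        *)
(* sequence (x n) of its residues 0 <= x n < p^n.  The bound is implied by the *)
(* coherence condition.                                                        *)
Section PadicIntegers.
Variables (p : nat) (p_pr : prime p).

Definition coherent (x : nat -> nat) : Prop :=
  forall n, (x n.+1 %% p ^ n)%N = x n.

Record padic_int_of (pr : prime p) := PadicInt {
  residue : nat -> nat;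
  residueP : `[< coherent residue >]
}.
Local Notation Zp := (padic_int_of p_pr).

HB.instance Definition _ := [isSub of Zp for @residue p_pr].
HB.instance Definition _ := [Choice of Zp by <:].

Implicit Types x y z : Zp.

Lemma padic_intP x n : (val x n.+1 %% p ^ n)%N = val x n.
Proof. by case: x => x /= /asboolP. Qed.

Lemma padic_int_mod x n : (val x n %% p ^ n)%N = val x n.
Proof. by rewrite -padic_intP modn_mod. Qed.

Lemma padic_int_ext x y : (forall n, val x n = val y n) -> x = y.
Proof. by move=> e; apply: val_inj; apply: funext. Qed.

Definition mk_padic_int (f : nat -> nat) (cf : coherent f) : Zp :=
  PadicInt p_pr (introT (asboolP _) cf).

Lemma modn_expS m n : (m %% p ^ n.+1 = m %[mod p ^ n])%N.
Proof. by rewrite modn_dvdm // expnS dvdn_mull. Qed.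

Lemma coherent_nat m : coherent (fun n => m %% p ^ n)%N.
Proof. by move=> n; rewrite modn_expS. Qed.

Lemma coherent_add x y : coherent (fun n => (val x n + val y n) %% p ^ n)%N.
Proof. by move=> n; rewrite modn_expS -modnDm !padic_intP. Qed.

Lemma coherent_mul x y : coherent (fun n => (val x n * val y n) %% p ^ n)%N.
Proof. by move=> n; rewrite modn_expS -modnMm !padic_intP. Qed.

Lemma padic_int_le x n : (val x n <= p ^ n)%N.
Proof. by rewrite -padic_int_mod ltnW // ltn_pmod // expn_gt0 prime_gt0. Qed.

Lemma coherent_opp x : coherent (fun n => (p ^ n - val x n) %% p ^ n)%N.
Proof.
move=> n; rewrite modn_expS; apply/eqP.
rewrite -(eqn_modDr (val x n)) subnK ?padic_int_le // modnn.
rewrite -[in X in (_ + X)%N]padic_intP modnDmr subnK ?padic_int_le //.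
by rewrite expnS modnMl.
Qed.

Definition padic_int_nat m := mk_padic_int (coherent_nat m).
Definition padic_int_add x y := mk_padic_int (coherent_add x y).
Definition padic_int_mul x y := mk_padic_int (coherent_mul x y).
Definition padic_int_opp x := mk_padic_int (coherent_opp x).

Lemma padic_int_addA : associative padic_int_add.
Proof.
by move=> x y z; apply: padic_int_ext => n /=; rewrite modnDmr modnDml addnA.
Qed.

Lemma padic_int_addC : commutative padic_int_add.
Proof. by move=> x y; apply: padic_int_ext => n /=; rewrite addnC. Qed.

Lemma padic_int_add0 : left_id (padic_int_nat 0) padic_int_add.
Proof.
by move=> x; apply: padic_int_ext => n /=; rewrite mod0n add0n padic_int_mod.
Qed.

Lemma padic_int_addN :
  left_inverse (padic_int_nat 0) padic_int_opp padic_int_add.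
Proof.
move=> x; apply: padic_int_ext => n /=.
by rewrite modnDml subnK ?padic_int_le // modnn mod0n.
Qed.

HB.instance Definition _ := GRing.isZmodule.Build Zp
  padic_int_addA padic_int_addC padic_int_add0 padic_int_addN.

Lemma padic_int_mulA : associative padic_int_mul.
Proof.
by move=> x y z; apply: padic_int_ext => n /=; rewrite modnMmr modnMml mulnA.
Qed.

Lemma padic_int_mulC : commutative padic_int_mul.
Proof. by move=> x y; apply: padic_int_ext => n /=; rewrite mulnC. Qed.

Lemma padic_int_mul1 : left_id (padic_int_nat 1) padic_int_mul.
Proof.
by move=> x; apply: padic_int_ext => n /=; rewrite modnMml mul1n padic_int_mod.
Qed.

Lemma padic_int_mulDl : left_distributive padic_int_mul padic_int_add.
Proof.
move=> x y z; apply: padic_int_ext => n /=.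
by rewrite modnMml modnDml modnDmr mulnDl.
Qed.

Lemma padic_int_1neq0 : padic_int_nat 1 != 0.
Proof.
apply/eqP => /(congr1 (fun x : Zp => val x 1%N)) /=.
by rewrite mod0n modn_small // expn1 prime_gt1.
Qed.

HB.instance Definition _ := GRing.Zmodule_isComNzRing.Build Zp
  padic_int_mulA padic_int_mulC padic_int_mul1 padic_int_mulDl padic_int_1neq0.

Definition padic_int_unit : {pred Zp} := fun x => `[< exists y, y * x = 1 >].
Definition padic_int_inv x : Zp :=
  if x \in padic_int_unit then xget 0 [set y | y * x = 1] else x.

Lemma padic_int_mulVx : {in padic_int_unit, left_inverse 1 padic_int_inv *%R}.
Proof.
move=> x ux; rewrite /padic_int_inv ux.
have /asboolP[y yx] := ux.
exact: (@xgetPex _ 0 [set y | y * x = 1] (ex_intro _ y yx)).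
Qed.

Lemma padic_int_unitPl x y : y * x = 1 -> x \in padic_int_unit.
Proof. by move=> yx; apply/asboolP; exists y. Qed.

Lemma padic_int_inv_out : {in [predC padic_int_unit], padic_int_inv =1 id}.
Proof. by move=> x; rewrite inE /padic_int_inv => /negbTE ->. Qed.

HB.instance Definition _ := GRing.ComNzRing_hasMulInverse.Build Zp
  padic_int_mulVx padic_int_unitPl padic_int_inv_out.

Lemma padic_int_neq0 x : x != 0 -> exists n, ~~ (p ^ n %| val x n)%N.
Proof.
move=> x0; apply: contrapT => /forallNP h; move/eqP: x0; apply.
apply: padic_int_ext => n /=; rewrite mod0n -padic_int_mod.
by apply/eqP; apply: contrapT => /negP; exact: h.
Qed.

Lemma padic_int_modD x n m : (val x (n + m) %% p ^ n)%N = val x n.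
Proof.
elim: m => [|m IH]; first by rewrite addn0 padic_int_mod.
rewrite addnS -IH -[in RHS]padic_intP modn_dvdm //.
by rewrite expnD dvdn_mulr.
Qed.

Lemma padic_int_idom x y : x * y = 0 -> (x == 0) || (y == 0).
Proof.
move=> xy0; apply/negPn/negP; rewrite negb_or => /andP[x0 y0].
have [n xn] := padic_int_neq0 x0; have [m ym] := padic_int_neq0 y0.
move/(congr1 (fun x : Zp => val x (n + m)%N)): xy0 => /=; rewrite mod0n.
move=> /eqP; rewrite -/(dvdn _ _).
have xn' : ~~ (p ^ n %| val x (n + m))%N.
  by apply: contra xn; rewrite /dvdn padic_int_modD padic_int_mod.
have ym' : ~~ (p ^ m %| val y (n + m))%N.
  by apply: contra ym; rewrite addnC /dvdn padic_int_modD padic_int_mod.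
have x_gt0 : (0 < val x (n + m))%N.
  by rewrite lt0n; apply: contra xn' => /eqP ->.
have y_gt0 : (0 < val y (n + m))%N.
  by rewrite lt0n; apply: contra ym' => /eqP ->.
rewrite pfactor_dvdn ?muln_gt0 ?x_gt0 // lognM //.
move: xn' ym'; rewrite !pfactor_dvdn // -!ltnNge => lx ly.
by rewrite leqNgt -addSn leq_add // ltnW.
Qed.

HB.instance Definition _ := GRing.ComUnitRing_isIntegral.Build Zp
  padic_int_idom.

End PadicIntegers.

Definition padic (p : nat) (p_pr : prime p) : fieldType :=
  {fraction (padic_int_of p_pr)}.

Section Padic.
Variables (p : nat) (p_pr : prime p).
Local Notation Zp := (padic_int_of p_pr).
Local Notation Qp := (padic p_pr).

Definition padic_integers : set Qp := range (@tofrac Zp).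

Definition padic_units : set Qp :=
  [set u : Qp | u != 0 /\ padic_integers u /\ padic_integers u^-1].

Definition padic_ideal (n : nat) : set Qp :=
  [set x : Qp | exists2 y, padic_integers y & x = p%:R ^+ n * y].

(* For x != 0, padic_val x is the only integer n with x in p^n Z_p^*. *)
Definition padic_val (x : Qp) : int :=
  xget 0 [set n : int | padic_units (x / p%:R ^ n)].

Definition padic_norm (R : realType) (x : Qp) : R :=
  if x == 0 then 0 else p%:R ^ (- padic_val x).

End Padic.

Section GL2.
Variable F : fieldType.

Record GL2 := MkGL2 { GL2_mx : 'M[F]_2; GL2_mxP : GL2_mx \in unitmx }.

HB.instance Definition _ := [isSub of GL2 for GL2_mx].
HB.instance Definition _ := [Choice of GL2 by <:].

Implicit Types g h : GL2.

Lemma GL2_unit g : val g \in unitmx. Proof. exact: valP. Qed.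

Lemma GL2_mul_subproof g h : val g *m val h \in unitmx.
Proof. by rewrite unitmx_mul !GL2_unit. Qed.

Lemma GL2_inv_subproof g : invmx (val g) \in unitmx.
Proof. by rewrite unitmx_inv GL2_unit. Qed.

Definition GL2_mul g h : GL2 := MkGL2 (GL2_mul_subproof g h).
Definition GL2_one : GL2 := MkGL2 (unitmx1 F 2).
Definition GL2_inv g : GL2 := MkGL2 (GL2_inv_subproof g).

Lemma GL2_mulA : associative GL2_mul.
Proof. by move=> g h k; apply: val_inj; rewrite /= mulmxA. Qed.
Lemma GL2_mul1g : left_id GL2_one GL2_mul.
Proof. by move=> g; apply: val_inj; rewrite /= mul1mx. Qed.
Lemma GL2_mulg1 : right_id GL2_one GL2_mul.
Proof. by move=> g; apply: val_inj; rewrite /= mulmx1. Qed.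
Lemma GL2_mulVg : left_inverse GL2_one GL2_inv GL2_mul.
Proof. by move=> g; apply: val_inj; rewrite /= mulVmx ?GL2_unit. Qed.
Lemma GL2_mulgV : right_inverse GL2_one GL2_inv GL2_mul.
Proof. by move=> g; apply: val_inj; rewrite /= mulmxV ?GL2_unit. Qed.

HB.instance Definition _ := isGroup.Build GL2
  GL2_mulA GL2_mul1g GL2_mulg1 GL2_mulVg GL2_mulgV.

Definition mx22 (a b c d : F) : 'M[F]_2 :=
  \matrix_(i, j) if i == 0 then (if j == 0 then a else b)
                 else (if j == 0 then c else d).

Lemma upper_unitmx (a b d : F) : a != 0 -> d != 0 -> mx22 a b 0 d \in unitmx.
Proof.
move=> a0 d0; rewrite unitmxE unitfE (expand_det_col _ ord0) big_ord_recl.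
rewrite big_ord1 !mxE /= mul0r addr0 mulf_neq0 //.
by rewrite /cofactor det_mx11 !mxE /= addn0 expr0 mul1r.
Qed.

Definition upper (a b d : F) (a0 : a != 0) (d0 : d != 0) : GL2 :=
  MkGL2 (upper_unitmx b a0 d0).

Definition unipotent (x : F) : GL2 := upper x (oner_neq0 F) (oner_neq0 F).

Definition homothety (z : F) (z0 : z != 0) : GL2 := upper 0 z0 z0.

End GL2.

Section Representations.
Variables (G : groupType) (C : numClosedFieldType).

Record representation := Representation {
  rep_space :> lmodType C;
  rep_act : G -> {linear rep_space -> rep_space};
  rep_act1 : forall v, rep_act 1%g v = v;
  rep_actM : forall g h v, rep_act (g * h)%g v = rep_act g (rep_act h v)
}.

Local Arguments rep_act {r} g.

Definition subrepresentation (pi : representation) (U : set pi) : Prop :=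
  [/\ U 0,
      forall (c : C) u v, U u -> U v -> U (c *: u + v)
    & forall g v, U v -> U (rep_act g v)].

Definition irreducible (pi : representation) : Prop :=
  (exists v : pi, v != 0) /\
  forall U : set pi, subrepresentation U -> U = [set 0] \/ U = setT.

(* Unitary in the sense of smooth representations: there is a G-invariant      *)
(* positive definite Hermitian form.                                           *)
Definition unitary (pi : representation) : Prop :=
  exists form : pi -> pi -> C,
  [/\ forall (c : C) u v w, form (c *: u + v) w = c * form u w + form v w,
      forall u v, form v u = (form u v)^*%R,
      forall v, v != 0 -> 0 < form v v
    & forall g u v, form (rep_act g u) (rep_act g v) = form u v].

(* pi is isomorphic to the space U of functions on G, on which G acts by right *)
(* translation.                                                                *)
Definition realized_on (pi : representation) (U : set (G -> C)) : Prop :=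
  exists T : pi -> (G -> C),
  [/\ forall (c : C) u v x, T (c *: u + v) x = c * T u x + T v x,
      injective T,
      range T = U
    & forall g v x, T (rep_act g v) x = T v (x * g)%g].

End Representations.

Arguments rep_act {G C r} g.

Section GL2Qp.
Variables (R : realType) (p : nat) (p_pr : prime p).
Local Notation C := R[i].
Local Notation Qp := (padic p_pr).
Local Notation G := (GL2 Qp).
Local Notation rep := (representation G C).

(* A character of Q_p^*, not necessarily of modulus 1; its value at 0 is       *)
(* irrelevant.  A homomorphism from Q_p^* to C^* is continuous if and only if  *)
(* it is trivial on a neighbourhood 1 + p^n Z_p of 1, n >= 1.                  *)
Definition quasi_character (chi : Qp -> C) : Prop :=
  [/\ forall x, x != 0 -> chi x != 0,
      forall x y, x != 0 -> y != 0 -> chi (x * y) = chi x * chi y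
    & exists2 n, (0 < n)%N &
        forall x, padic_ideal n x -> chi (1 + x) = 1].

Definition unramified (chi : Qp -> C) : Prop :=
  forall u, padic_units u -> chi u = 1.

Definition unramified_additive_character (psi : Qp -> C) : Prop :=
  [/\ forall x y, psi (x + y) = psi x * psi y,
      forall x, padic_integers x -> psi x = 1
    & exists2 x, padic_integers x & psi (x / p%:R) != 1].

Definition GL2Zp : set G :=
  [set k : G | (forall i j, padic_integers (val k i j)) /\
           padic_units (\det (val k))].

Definition congruence_K0 (r : nat) : set G :=
  [set k : G | GL2Zp k /\ padic_ideal r (val k 1 0)].

Definition principal_congruence (r : nat) : set G :=
  [set k : G | GL2Zp k /\
           forall i j, padic_ideal r (val k i j - (i == j)%:R)].

(* Normalized smooth induction of chi1 (x) chi2 from the Borel subgroup. *)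
Definition induced (chi1 chi2 : Qp -> C) : set (G -> C) :=
  [set f : G -> C |
    (forall (a b d : Qp) (a0 : a != 0) (d0 : d != 0) g,
       f (upper b a0 d0 * g)%g =
       chi1 a * chi2 d * (Num.sqrt (padic_norm R (a / d)))%:C * f g) /\
    (exists n, forall k g, principal_congruence n k -> f (g * k)%g = f g)].

Definition principal_series (pi : rep) (chi1 chi2 : Qp -> C) : Prop :=
  [/\ quasi_character chi1, quasi_character chi2,
      irreducible pi & realized_on pi (induced chi1 chi2)].

Definition twist_minimal_principal_series (pi : rep) : Prop :=
  exists chi1 chi2,
    principal_series pi chi1 chi2 /\ (unramified chi1 \/ unramified chi2).

Definition central_character (pi : rep) (omega : Qp -> C) : Prop :=
  forall (z : Qp) (z0 : z != 0) (v : pi),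
    rep_act (homothety z0) v = omega z *: v.

(* The scalar by which k in K_0(p^r) acts on a newvector.  For r = 0 the lower *)
(* right entry of k need not be a unit, and the condition is invariance.       *)
Definition newvector_scalar (omega : Qp -> C) (r : nat) (k : G) : C :=
  if r == 0%N then 1 else omega (val k 1 1).

Definition has_newvector (pi : rep) (omega : Qp -> C) (r : nat) : Prop :=
  exists2 v : pi, v != 0 &
    forall k, congruence_K0 r k -> rep_act k v = newvector_scalar omega r k *: v.

(* The conductor of pi is p^r (Casselman), omega being the central character. *)
Definition conductor_exponent (pi : rep) (omega : Qp -> C) (r : nat) : Prop :=
  has_newvector pi omega r /\
  forall s, has_newvector pi omega s -> (r <= s)%N.

Definition whittaker_model (psi : Qp -> C) (pi : rep) (W : set (G -> C)) :
    Prop :=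
  realized_on pi W /\
  forall w, W w -> forall x g, w (unipotent x * g)%g = psi x * w g.

Definition whittaker_newvector (omega : Qp -> C) (r : nat) (W : set (G -> C))
    (w : G -> C) : Prop :=
  [/\ W w, w <> cst 0 &
      forall k g, congruence_K0 r k ->
        w (g * k)%g = newvector_scalar omega r k * w g].

End GL2Qp.

(* Main.v *)
Require Import Defs.
From mathcomp Require Import all_boot all_order all_algebra.
From mathcomp Require Import fraction complex generic_quotient.
From mathcomp Require Import boolp classical_sets functions reals.
From mathcomp Require Import cyclic ring.

Set Implicit Arguments.
Unset Strict Implicit.
Unset Printing Implicit Defensive.

Import Order.TTheory GRing.Theory Num.Theory.

Local Open Scope ring_scope.
Local Open Scope classical_set_scope.
Local Open Scope complex_scope.

(** Write O for the p-adic integers, n(x) and n'(x) for the upper and lower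
    unipotent matrices with entry x, a(y) = diag(y, 1), w0 for the Weyl element
    and K for K_0(p^2).  The group is the union of B K, B n'(p) K and B w0 K, so
    that the absolute values of the newvector are those of the three functions
      E(y) = W(a(y)),  F(y) = W(a(y) n'(p)),  H(y) = W(a(y) w0).
    They are tied together by one relation, an eigenvector equation
      sum_(x mod p) n(x) a(p) v = c v
    for the newvector v, with |c| = p^(1/2).

    - The operator on the left maps newvectors to newvectors, and newvectors are
      unique up to a scalar: in the induced model, a newvector vanishes on two of
      the three double cosets, because the ramified inducing character is
      nontrivial on 1 + pO.  This gives some eigenvalue c.
    - The vectors n(x) a(p) v are eigenvectors of the n'(pt), t in O, for the
      characters t |-> omega(1 + ptx).  These are pairwise distinct, so the
      vectors are orthogonal for the invariant form, and all of them have the norm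
      of v.  Hence |c|^2 = p.  This is where unitarity enters.
    - That omega is nontrivial on 1 + pO follows from the minimality of the
      conductor: otherwise an explicit function in the induced model is a vector
      of level p.

    Applied to W, the equation and the covariance of W give the following.  First,
    E is supported on O and |E(p^n u)| = p^(-n/2) |W(1)|.  Next, as n'(p) is
    almost normalised by n(O), F is supported on the y for which
    x |-> psi(yx) omega(1 + px) is trivial on O; such a y has valuation -1, and
    there all p terms of c F(y) = sum_x psi(yx) omega(1 + px) E(py) are equal, so
    that |F(y)| = p |E(py)| / |c| = p^(1/2) |W(1)|.  Such y exist, since every
    character of O / pO is of the form psi(j x / p).  Finally
      c H(y) = omega(p) H(y/p) + sum_(0 < x < p) e(x) F(py/x)
    with |e(x)| = 1 has at most one nonzero term on the right, which gives
    |H| <= |W(1)| by induction on the valuation.  So the maximum is attained by F.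

    Below, n(x), n'(x), a(y) and w0 are unip x, lunip x, torus y and weyl.  The
    argument uses only the few properties of the p-adic integers collected in
    p_valued, and is carried out over any field F with a subring O that has
    them. *)

(** * Divisibility in the p-adic integers *)

Section PadicIntegers.
Variables (p : nat) (p_pr : prime p).
Local Notation Zp := (padic_int_of p_pr).
Implicit Types x y : Zp.

Lemma residueD x y n : val (x + y) n = ((val x n + val y n) %% p ^ n)%N.
Proof. by []. Qed.

Lemma residueB x y n :
  val (x - y) n = ((val x n + (p ^ n - val y n) %% p ^ n) %% p ^ n)%N.
Proof. by []. Qed.

Lemma residueM x y n : val (x * y) n = ((val x n * val y n) %% p ^ n)%N.
Proof. by []. Qed.

Lemma residue_nat m n : val (m%:R : Zp) n = (m %% p ^ n)%N.
Proof.
elim: m => [|m IH]; first by rewrite mod0n /= mod0n.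
by rewrite -addn1 natrD residueD IH /= modnDm.
Qed.

(** The inverse modulo p^n is the power phi(p^n) - 1; coherence follows from the
    uniqueness of inverses. *)
Lemma padic_int_inverse x : val x 1%N != 0%N -> exists y, y * x = 1.
Proof.
move=> x1; have cop n : coprime (val x n) (p ^ n).
  case: n => [|n]; first by rewrite coprimen1.
  rewrite coprime_sym coprimeXl // prime_coprime //; apply: contra x1 => px.
  by rewrite -(padic_int_modD x 1 n) add1n expn1.
pose y n := (val x n ^ (totient (p ^ n)).-1 %% p ^ n)%N.
have yx n : (y n * val x n = 1 %[mod p ^ n])%N.
  rewrite /y modnMml -expnSr prednK ?totient_gt0 ?expn_gt0 ?prime_gt0 //.
  exact: Euler_exp_totient.
have cy : coherent p y.
  move=> n; set a := y n.+1; have yE : (y n %% p ^ n)%N = y n by rewrite modn_mod.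
  rewrite -yE.
  have ax : (a * val x n = 1 %[mod p ^ n])%N.
    by rewrite -(padic_intP x n) modnMmr -modn_expS yx modn_expS.
  rewrite -[a]muln1 -modnMmr -(yx n) modnMmr mulnCA -modnMmr ax modnMmr muln1.
  by [].
exists (mk_padic_int p_pr cy); apply: padic_int_ext => n.
by rewrite residueM /= yx.
Qed.

Lemma padic_int_divp x : val x 1%N = 0%N -> exists y, x = p%:R * y.
Proof.
move=> x1; have p0 := prime_gt0 p_pr.
have px n : (p %| val x n.+1)%N.
  by rewrite /dvdn -[X in (_ %% X)%N](expn1 p) -add1n padic_int_modD x1.
pose y n := (val x n.+1 %/ p)%N.
have cy : coherent p y.
  move=> n; apply/eqP; rewrite -(eqn_pmul2r p0) muln_modl -expnSr /y !divnK //.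
  by rewrite padic_intP.
exists (mk_padic_int p_pr cy); apply: padic_int_ext => n.
rewrite residueM residue_nat /= modnMml mulnC /y divnK //.
by rewrite padic_intP.
Qed.

Lemma padic_int_factor x :
  x != 0 -> exists n y, val y 1%N != 0%N /\ x = p%:R ^+ n * y.
Proof.
move=> x0; have [n] := padic_int_neq0 x0; elim: n x x0 => [|n IH] x x0 xn.
  by rewrite expn0 dvd1n in xn.
have [x1|x1] := eqVneq (val x 1%N) 0%N; last by exists 0%N, x; rewrite mul1r.
have [y xy] := padic_int_divp x1.
have y0 : y != 0 by apply: contra x0 => /eqP y0; rewrite xy y0 mulr0.
have yn : ~~ (p ^ n %| val y n)%N.
  apply: contra xn => yn; rewrite xy residueM residue_nat modnMml /dvdn modn_mod.
  rewrite -/(dvdn _ _) expnS dvdn_pmul2l ?prime_gt0 //.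
  by rewrite /dvdn -addn1 padic_int_modD -padic_int_mod -/(dvdn _ _).
have [m [z [z1 yz]]] := IH y y0 yn.
by exists m.+1, z; split=> //; rewrite xy yz exprS mulrA.
Qed.

End PadicIntegers.

(** * Fields with a p-adic ring of integers *)

Section ValuedField.
Variables (p : nat) (F : fieldType) (O : set F).
Implicit Types x y u : F.

Definition units : set F := [set u | u != 0 /\ O u /\ O u^-1].

Definition ideal (n : nat) : set F :=
  [set x | exists2 y, O y & x = p%:R ^+ n * y].

(** O is a discrete valuation ring of F with uniformiser p and residue field F_p. *)
Record p_valued : Prop := PValued {
  pv_prime : prime p;
  pv_1 : O 1;
  pv_B : forall x y, O x -> O y -> O (x - y);
  pv_M : forall x y, O x -> O y -> O (x * y);
  pv_p_neq0 : p%:R != 0 :> F;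
  pv_p_nonunit : ~ O (p%:R^-1);
  pv_local : forall x, O x -> ~ ideal 1 x -> O x^-1;
  pv_val : forall x, x != 0 -> exists k : int, units (x / p%:R ^ k);
  pv_residue : forall x, O x -> exists2 m, (m < p)%N & ideal 1 (x - m%:R)
}.

Hypothesis pv : p_valued.
Local Notation U := units.
Local Notation P := ideal.
Let p_neq0 := pv_p_neq0 pv.

Lemma integers1 : O 1. Proof. exact: pv_1. Qed.
Lemma integersB x y : O x -> O y -> O (x - y). Proof. exact: pv_B. Qed.
Lemma integersM x y : O x -> O y -> O (x * y). Proof. exact: pv_M. Qed.
Lemma integers0 : O 0.
Proof. by rewrite -(subrr 1); apply: integersB; exact: integers1. Qed.
Lemma integersN x : O x -> O (- x).
Proof. by move=> Ox; rewrite -sub0r; apply: integersB => //; exact: integers0. Qed.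
Lemma integersD x y : O x -> O y -> O (x + y).
Proof. by move=> Ox Oy; rewrite -(opprK y); apply: integersB => //; exact: integersN. Qed.
Lemma integers_nat n : O n%:R.
Proof.
elim: n => [|n IH]; first exact: integers0.
by rewrite -natr1; apply: integersD => //; exact: integers1.
Qed.
Lemma integersX x n : O x -> O (x ^+ n).
Proof.
move=> Ox; elim: n => [|n IH]; first exact: integers1.
by rewrite exprS; exact: integersM.
Qed.

Lemma idealP n x : P n x <-> O (x / p%:R ^+ n).
Proof.
have pn : p%:R ^+ n != 0 :> F by rewrite expf_neq0 // p_neq0.
split=> [[y Oy ->]|Ox]; first by rewrite mulrAC mulfV ?mul1r.
by exists (x / p%:R ^+ n) => //; rewrite mulrC divfK.
Qed.

Lemma ideal0 n : P n 0.
Proof. by apply/idealP; rewrite mul0r; exact: integers0. Qed.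
Lemma idealD n x y : P n x -> P n y -> P n (x + y).
Proof. by rewrite !idealP mulrDl; exact: integersD. Qed.
Lemma idealN n x : P n x -> P n (- x).
Proof. by rewrite !idealP mulNr; exact: integersN. Qed.
Lemma idealB n x y : P n x -> P n y -> P n (x - y).
Proof. by rewrite !idealP mulrBl; exact: integersB. Qed.
Lemma idealMl n x y : P n x -> O y -> P n (x * y).
Proof. by rewrite !idealP => Px Oy; rewrite mulrAC; exact: integersM. Qed.
Lemma idealMr n x y : O x -> P n y -> P n (x * y).
Proof. by move=> Ox Py; rewrite mulrC; exact: idealMl. Qed.
Lemma ideal_exp n x : O x -> P n (p%:R ^+ n * x).
Proof. by exists x. Qed.
Lemma ideal_p x : O x -> P 1 (p%:R * x).
Proof. by move=> Ox; rewrite -[p%:R]expr1; exact: ideal_exp. Qed.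
Lemma ideal_leq m n x : (m <= n)%N -> P n x -> P m x.
Proof.
move=> /subnKC <- [a Oa ->]; rewrite exprD -mulrA; apply: ideal_exp.
by apply: integersM => //; rewrite -natrX; exact: integers_nat.
Qed.
Lemma ideal_0P x : P 0 x <-> O x.
Proof. by rewrite idealP expr0 divr1. Qed.
Lemma ideal_integer n x : P n x -> O x.
Proof. by move=> Px; apply/ideal_0P; exact: ideal_leq Px. Qed.

Lemma unitsP x : U x <-> O x /\ ~ P 1 x.
Proof.
split=> [[x0 [Ox Ox']]|[Ox Px]].
  split=> // /idealP; rewrite expr1 => Oxp; apply: (pv_p_nonunit pv).
  by have := integersM Oxp Ox'; rewrite mulrAC mulfV // mul1r.
split; last by split=> //; exact: pv_local.
by apply/eqP => x0; apply: Px; rewrite x0; exact: ideal0.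
Qed.

Lemma units_neq0 x : U x -> x != 0. Proof. by case. Qed.
Lemma units_int x : U x -> O x. Proof. by case=> _ []. Qed.
Lemma units1 : U 1.
Proof. by split; rewrite ?invr1 ?oner_neq0; split; try exact: integers1. Qed.
Lemma unitsV x : U x -> U x^-1.
Proof. by case=> x0 [Ox Ox']; split; rewrite ?invr_eq0 // invrK. Qed.
Lemma unitsM x y : U x -> U y -> U (x * y).
Proof.
move=> [x0 [Ox Ox']] [y0 [Oy Oy']]; split; rewrite ?mulf_neq0 //.
by rewrite invfM; split; exact: integersM.
Qed.
Lemma unitsD x y : U x -> P 1 y -> U (x + y).
Proof.
move=> /unitsP[Ox Px] Py; apply/unitsP; split.
  by apply: integersD => //; exact: ideal_integer Py.
by move=> Pxy; apply: Px; have := idealB Pxy Py; rewrite addrK.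
Qed.
Lemma units_ideal x : U x -> ~ P 1 x. Proof. by move=> /unitsP[]. Qed.

Lemma units_nat n : (0 < n < p)%N -> U n%:R.
Proof.
move=> /andP[n0 np]; apply/unitsP; split; first exact: integers_nat.
have : coprime n p.
  rewrite coprime_sym prime_coprime ?(pv_prime pv) //.
  by apply/negP => /(dvdn_leq n0); rewrite leqNgt np.
move=> /(coprimeP _ n0)[[u v] /= e] Pn; apply: (units_ideal units1).
have -> : 1 = u%:R * n%:R - v%:R * p%:R :> F.
  by rewrite -!natrM -natrB ?e //; apply: ltnW; rewrite -subn_gt0 e.
apply: idealB; first by apply: idealMr => //; exact: integers_nat.
by rewrite mulrC; apply: ideal_p; exact: integers_nat.
Qed.

Lemma residue_inj (m n : nat) :
  (m < p)%N -> (n < p)%N -> P 1 (m%:R - n%:R) -> m = n.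
Proof.
wlog mn : m n / (m <= n)%N.
  move=> H; case: (leqP m n) => [|/ltnW] mn mp np Pmn; first exact: H.
  by apply/esym/H => //; rewrite -opprB; exact: idealN.
move=> mp np Pmn; apply/eqP; rewrite eqn_leq mn leqNgt; apply/negP => lt_mn.
apply: (@units_ideal (n - m)%:R).
  by apply: units_nat; rewrite subn_gt0 lt_mn (leq_ltn_trans (leq_subr _ _)).
by rewrite natrB // -opprB; exact: idealN.
Qed.

Lemma integer_or_inverse x : x != 0 -> O x \/ P 1 x^-1.
Proof.
move=> x0; have [[k|k] [_ [Ox Ox']]] := pv_val pv x0; [left|right].
  apply/ideal_0P; apply: (@ideal_leq _ k) => //; apply/idealP.
  exact: Ox.
apply: (@ideal_leq _ k.+1) => //; apply/idealP.
by rewrite -invfM mulrC; move: Ox'; rewrite invfM invrK mulrC invfM.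
Qed.

Lemma not_ideal_inverse x : ~ P 1 x -> x != 0 /\ O x^-1.
Proof.
move=> Px; have x0 : x != 0 by apply/eqP => x0; apply: Px; rewrite x0; exact: ideal0.
split=> //; have [//|] : O x^-1 \/ P 1 x^-1^-1.
  by apply: integer_or_inverse; rewrite invr_eq0.
by rewrite invrK.
Qed.

Lemma units_expz (k : int) : U (p%:R ^ k) -> k = 0.
Proof.
have H n : ~ U (p%:R ^+ n.+1).
  by move=> /units_ideal; apply; rewrite exprS; apply/ideal_p/integersX/integers_nat.
case: k => [[|n]|n] //; first by move=> /H.
by move=> /unitsV; rewrite -[_ ^ _]/(_ ^- n.+1) invrK => /H.
Qed.

Definition pval x : int := xget 0 [set n : int | U (x / p%:R ^ n)].

Lemma pvalP x : x != 0 -> U (x / p%:R ^ pval x).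
Proof. by move=> /(pv_val pv) [n Un]; rewrite /pval; case: xgetP => // /(_ n). Qed.

Lemma pval_uniq x n : U (x / p%:R ^ n) -> pval x = n.
Proof.
move=> Un; have x0 : x != 0.
  by have := units_neq0 Un; apply: contra => /eqP ->; rewrite mul0r.
apply/esym/eqP; rewrite -subr_eq0; apply/eqP/units_expz.
have := unitsM (pvalP x0) (unitsV Un).
by rewrite invfM invrK mulrACA mulfV // mul1r mulrC invr_expz -expfzDr.
Qed.

(** For the p-adic numbers this is, by definition, the p-adic absolute value. *)
Definition vnorm (R : realType) x : R := if x == 0 then 0 else p%:R ^ (- pval x).

Lemma vnormM (R : realType) x y :
  x != 0 -> y != 0 -> vnorm R (x * y) = vnorm R x * vnorm R y.
Proof.
move=> x0 y0; rewrite /vnorm mulf_eq0 (negbTE x0) (negbTE y0) /=.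
rewrite (@pval_uniq _ (pval x + pval y)); last first.
  by rewrite expfzDr // invfM mulrACA; apply: unitsM; exact: pvalP.
by rewrite opprD expfzDr // pnatr_eq0 -lt0n prime_gt0 // (pv_prime pv).
Qed.

Lemma vnorm_unit (R : realType) u : U u -> vnorm R u = 1.
Proof.
move=> Uu; rewrite /vnorm (negbTE (units_neq0 Uu)).
by rewrite (@pval_uniq _ 0) ?oppr0 ?expr0z // divr1.
Qed.

Lemma vnorm_ge0 (R : realType) x : 0 <= vnorm R x.
Proof. by rewrite /vnorm; case: ifP => // _; rewrite exprz_ge0. Qed.

Lemma integer_factor x :
  O x -> x != 0 -> exists n u, U u /\ x = p%:R ^+ n * u.
Proof.
move=> Ox x0; have [[n|n] Un] := pv_val pv x0; last first.
  case: (units_ideal Un); rewrite -[_ ^ Negz n]/(_ ^- n.+1) invrK mulrC exprS -mulrA.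
  by apply: ideal_p; apply: integersM => //; exact/integersX/integers_nat.
exists n, (x / p%:R ^ n); split=> //; apply/esym.
by rewrite mulrC divfK // expfz_neq0.
Qed.

(** The point (c : d) of the projective line reduces modulo p either to (0 : 1) or
    to an affine point; this separates the small cell from the large one. *)
Lemma ratio_or_inverse c d : (c != 0) || (d != 0) ->
  ~ (d != 0 /\ P 1 (c / d)) -> c != 0 /\ O (d / c).
Proof.
move=> cd H; have [d0|d0] := eqVneq d 0.
  rewrite d0 mul0r; split; last exact: integers0.
  by move: cd; rewrite d0 eqxx orbF.
have [|cd0 Ocd] := @not_ideal_inverse (c / d); first by move=> Pcd; apply: H.
split; last by rewrite invfM invrK mulrC in Ocd.
by apply: contra cd0 => /eqP ->; rewrite mul0r.
Qed.

End ValuedField.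

(** * The p-adic numbers form such a field *)

Lemma units_div (F : fieldType) (O : set F) (x y : F) :
  (forall x y, O x -> O y -> O (x * y)) -> units O x -> units O y ->
  units O (x / y).
Proof.
move=> OM [x0 [Ox Ox']] [y0 [Oy Oy']].
split; first by rewrite mulf_neq0 ?invr_eq0.
by rewrite invfM invrK; split; exact: OM.
Qed.

Lemma divf_exp_diff (F : fieldType) (q c d : F) (m n : nat) :
  q != 0 -> d != 0 ->
  q ^+ m * c / (q ^+ n * d) / q ^ (m%:Z - n%:Z) = c / d.
Proof.
move=> q0 d0; rewrite expfzDr // -exprnN -exprnP.
by field; rewrite d0 !expf_neq0.
Qed.

Section Padic.
Variables (p : nat) (p_pr : prime p).
Local Notation Zp := (padic_int_of p_pr).
Local Notation Qp := (padic p_pr).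
Local Notation O := (@padic_integers p p_pr).

Lemma padic_p_neq0 : p%:R != 0 :> Qp.
Proof.
have -> : p%:R = tofrac (p%:R : Zp) :> Qp by rewrite rmorph_nat.
rewrite /padic tofrac_eq0; apply/eqP => /(congr1 (fun x : Zp => val x 2%N)).
rewrite residue_nat /= mod0n modn_small; first by have := prime_gt0 p_pr; case: (p).
by rewrite -{1}(expn1 p) ltn_exp2l // prime_gt1.
Qed.

Lemma fractionE (D : idomainType) (x : {fraction D}) :
  exists a b, b != 0 /\ x = tofrac a / tofrac b.
Proof.
elim/quotW: x => r; exists (frac r).1, (frac r).2.
have b0 := denom_ratioP r; split=> //.
apply: (@mulIf _ (tofrac (frac r).2)); first by rewrite tofrac_eq0.
rewrite divfK ?tofrac_eq0 //.
unlock FracField.tofrac; rewrite -[LHS]FracField.pi_mul /FracField.mulf.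
apply/eqmodP; rewrite /= FracField.equivfE.
by rewrite !numden_Ratio ?mulf_neq0 ?oner_neq0 // !mulr1 mulrC.
Qed.

Lemma units_tofrac (y : Zp) : val y 1%N != 0%N -> units O (tofrac y).
Proof.
move=> y1; have [z zy] := padic_int_inverse y1.
have zyF : tofrac z * tofrac y = 1 :> Qp.
  by apply/eqP; rewrite -[X in X == _]tofracM zy; apply/eqP/tofrac1.
have y0 : tofrac y != 0 :> Qp.
  by apply/eqP => y0; move/eqP: zyF; rewrite y0 mulr0 eq_sym; apply/negP/oner_neq0.
split=> //; split; first by exists y.
by exists z => //; apply: (mulIf y0); rewrite zyF mulVf.
Qed.

Lemma padic_p_valued : p_valued p O.
Proof.
have p0 := padic_p_neq0.
have OM x y : O x -> O y -> O (x * y).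
  by move=> [a _ <-] [b _ <-]; exists (a * b) => //; exact: rmorphM.
split=> //.
- by exists 1 => //; exact: rmorph1.
- by move=> x y [a _ <-] [b _ <-]; exists (a - b) => //; exact: rmorphB.
- move=> [y _ yp]; have : y * p%:R = 1.
    apply/eqP; rewrite -(@tofrac_eq Zp) tofrac1 tofracM yp.
    by rewrite [tofrac p%:R]rmorph_nat; apply/eqP; exact: (mulVf p0).
  move=> /(congr1 (fun x : Zp => val x 1%N)); rewrite residueM residue_nat /=.
  by rewrite expn1 modnn muln0 mod0n modn_small ?prime_gt1.
- move=> x [a _ <-] Px; have [a1|a1] := eqVneq (val a 1%N) 0%N; last first.
    by case: (units_tofrac a1) => _ [].
  have [b ab] := padic_int_divp a1; case: Px; exists (tofrac b); first by exists b.
  by rewrite ab tofracM [tofrac p%:R]rmorph_nat.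
- move=> x x0; have [a [b [b0 xab]]] := fractionE x.
  have a0 : a != 0.
    by apply: contra x0 => /eqP a0; rewrite xab a0 tofrac0 mul0r.
  have [m [c [c1 ac]]] := padic_int_factor a0.
  have [n [d [d1 bd]]] := padic_int_factor b0.
  exists (m%:Z - n%:Z); have [uc ud] := (units_tofrac c1, units_tofrac d1).
  have -> : x / p%:R ^ (m%:Z - n%:Z) = tofrac c / tofrac d.
    rewrite xab ac bd !tofracM !tofracXn ![tofrac p%:R]rmorph_nat.
    exact: (divf_exp_diff _ _ _ p0 (proj1 ud)).
  exact: units_div OM uc ud.
- move=> x [a _ <-]; exists (val a 1%N).
    by rewrite -padic_int_mod expn1 ltn_pmod ?prime_gt0.
  have [|b ab] := @padic_int_divp _ p_pr (a - (val a 1%N)%:R).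
    rewrite residueB residue_nat padic_int_mod modnDmr subnKC ?modnn //.
    exact: padic_int_le.
  exists (tofrac b); first by exists b.
  have -> : (val a 1%N)%:R = tofrac (val a 1%N)%:R :> Qp by rewrite rmorph_nat.
  have <- : tofrac (p%:R ^+ 1) = p%:R ^+ 1 :> Qp by rewrite rmorphXn rmorph_nat.
  by rewrite -[LHS]tofracB ab; exact: tofracM.
Qed.

End Padic.

(** * Explicit two by two matrices *)

Section Matrices.
Variable F : fieldType.
Implicit Types (a b c d x y z : F) (g h k : GL2 F).

Lemma det_mx22 (A : 'M[F]_2) : \det A = A 0 0 * A 1 1 - A 0 1 * A 1 0.
Proof.
rewrite (expand_det_row _ ord0) !big_ord_recl big_ord0 addr0.
rewrite /cofactor !det_mx11 !mxE /= expr0 mul1r expr1 mulN1r mulrN.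
by congr (A _ _ * A _ _ - A _ _ * A _ _); apply: val_inj.
Qed.

(** The value is the identity when the determinant ad - bc vanishes, so that
    explicit matrices can be written without a proof of invertibility. *)
Definition gl a b c d : GL2 F := insubd (GL2_one F) (mx22 a b c d).

Lemma val_gl a b c d : a * d - b * c != 0 -> val (gl a b c d) = mx22 a b c d.
Proof. by move=> D; rewrite val_insubd unitmxE det_mx22 !mxE /= unitfE D. Qed.

Lemma gl_entries a b c d : a * d - b * c != 0 ->
  (val (gl a b c d) 0 0 = a) * (val (gl a b c d) 0 1 = b) *
  (val (gl a b c d) 1 0 = c) * (val (gl a b c d) 1 1 = d).
Proof. by move=> D; rewrite val_gl // !mxE. Qed.

Lemma det_gl a b c d : a * d - b * c != 0 -> \det (val (gl a b c d)) = a * d - b * c.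
Proof. by move=> D; rewrite det_mx22 !gl_entries. Qed.

Lemma GL2_det g : val g 0 0 * val g 1 1 - val g 0 1 * val g 1 0 != 0.
Proof. by rewrite -det_mx22 -unitfE -unitmxE GL2_unit. Qed.

Lemma mx22P (A B : 'M[F]_2) : A 0 0 = B 0 0 -> A 0 1 = B 0 1 -> A 1 0 = B 1 0 ->
  A 1 1 = B 1 1 -> A = B.
Proof.
move=> e00 e01 e10 e11; apply/matrixP => i j.
by case: i => [[|[|//]] ?]; case: j => [[|[|//]] ?]; rewrite -?e00 -?e01 -?e10 -?e11;
  [move: e00 | move: e01 | move: e10 | move: e11] => e;
  (etransitivity; [|etransitivity; [exact e|]]);
  congr (_ _ _); apply: val_inj.
Qed.

Lemma gl_eta g : g = gl (val g 0 0) (val g 0 1) (val g 1 0) (val g 1 1).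
Proof.
have e := gl_entries (GL2_det g).
by apply: val_inj; apply: mx22P; rewrite e.
Qed.

Lemma glM a b c d a' b' c' d' :
  a * d - b * c != 0 -> a' * d' - b' * c' != 0 ->
  (gl a b c d * gl a' b' c' d')%g =
  gl (a * a' + b * c') (a * b' + b * d') (c * a' + d * c') (c * b' + d * d').
Proof.
move=> D D'.
have D2 : (a * a' + b * c') * (c * b' + d * d') -
   (a * b' + b * d') * (c * a' + d * c') != 0.
  rewrite (_ : _ - _ = (a * d - b * c) * (a' * d' - b' * c')); last by ring.
  by rewrite mulf_neq0.
apply: val_inj; rewrite [LHS]/= !val_gl //.
by apply: mx22P; rewrite !mxE !big_ord_recl big_ord0 addr0 !mxE.
Qed.

Lemma upperE a b d (a0 : a != 0) (d0 : d != 0) : upper b a0 d0 = gl a b 0 d.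
Proof.
by apply: val_inj; rewrite val_gl // mulr0 subr0 mulf_neq0.
Qed.

Lemma gl1 : 1%g = gl 1 0 0 1.
Proof.
apply: val_inj; rewrite val_gl ?mulr0 ?subr0 ?mul1r ?oner_neq0 //.
by apply: mx22P; rewrite !mxE.
Qed.

Definition unip x := gl 1 x 0 1.
Definition lunip x := gl 1 0 x 1.
Definition torus y := gl y 0 0 1.
Definition scal z := gl z 0 0 z.
Definition weyl := gl 0 (-1) 1 0.

End Matrices.

Ltac gl_det :=
  try assumption;
  rewrite ?(mulr0, mul0r, mulr1, mul1r, subr0, sub0r, add0r, addr0, mulrN1, mulN1r, opprK);
  rewrite ?(opprK, subrK, addrK);
  rewrite ?(oner_neq0, oppr_eq0) //; rewrite ?mulf_neq0 ?invr_eq0 ?oner_neq0 ?oppr_eq0 //.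
(** Reduces an equality between products of explicit matrices to the equality of
    the four entries. *)
Ltac gl_eq := rewrite /unip /lunip /torus /scal /weyl; rewrite !glM; [congr gl | gl_det ..].

Section Identities.
Variable F : fieldType.
Implicit Types (a b c d x y z s q : F) (g h k : GL2 F).

Lemma torus_unip y x : y != 0 -> (torus y * unip x)%g = (unip (y * x) * torus y)%g.
Proof. by move=> y0; gl_eq; ring. Qed.

Lemma torusM x y : x != 0 -> y != 0 -> (torus x * torus y)%g = torus (x * y).
Proof. by move=> x0 y0; gl_eq; ring. Qed.

Lemma scalC z g : z != 0 -> (g * scal z)%g = (scal z * g)%g.
Proof.
move=> z0; rewrite (gl_eta g); have D := GL2_det g.
by gl_eq; ring.
Qed.

(** Conjugating n'(qs) by n(x) a(q) lands, for q = p, in K_0(p^2), with lower right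
    entry 1 + qsx: this makes n(x) a(p) v an eigenvector of n'(ps). *)
Lemma lunip_unip_torus q s x : q != 0 ->
  (lunip (q * s) * (unip x * torus q))%g =
  ((unip x * torus q) * gl (1 - q * s * x) (- s * x ^+ 2) (q ^+ 2 * s) (1 + q * s * x))%g.
Proof.
move=> q0.
have D : (1 - q * s * x) * (1 + q * s * x) - (- s * x ^+ 2) * (q ^+ 2 * s) != 0.
  by rewrite (_ : _ - _ = 1) ?oner_neq0 //; ring.
by gl_eq; ring.
Qed.

(** For q = p the right factor lies in K_0(p^2): translating by n(x) on the left of
    n'(p) costs only the scalar omega(1 - px). *)
Lemma unip_lunip q x :
  (unip x * lunip q)%g = (lunip q * gl (1 + q * x) x (- q ^+ 2 * x) (1 - q * x))%g.
Proof.
have D : (1 + q * x) * (1 - q * x) - x * (- q ^+ 2 * x) != 0.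
  by rewrite (_ : _ - _ = 1) ?oner_neq0 //; ring.
by gl_eq; ring.
Qed.

Lemma unip_weyl x : (unip x * weyl F)%g = (weyl F * lunip (- x))%g.
Proof. by gl_eq; ring. Qed.

(** For q = p and x a unit, the coset of w0 n(x) a(p) is the middle one. *)
Lemma weyl_unip_torus q x : q != 0 -> x != 0 ->
  (weyl F * (unip x * torus q))%g =
  (scal x * (unip (- x^-1) * (torus (q / x) * (lunip q * torus x^-1))))%g.
Proof. by move=> q0 x0; gl_eq; field. Qed.

Lemma weyl_torus q : q != 0 -> (weyl F * torus q)%g = (scal q * (torus q^-1 * weyl F))%g.
Proof. by move=> q0; gl_eq; field. Qed.

Lemma unipD_torus x q s : q != 0 ->
  (unip (x + q * s) * torus q)%g = (unip x * torus q * unip s)%g.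
Proof. by move=> q0; gl_eq; ring. Qed.

(** The elements of K_0(p) permute the cosets n(x) a(p) K_0(p^2) by the
    homographies x |-> (ax + b) / (cx + d). *)
Lemma gl_unip_torus q a b c d x :
  q != 0 -> a * d - b * c != 0 -> c * x + d != 0 ->
  (gl a b c d * (unip x * torus q))%g =
  (unip ((a * x + b) / (c * x + d)) * torus q *
   gl (a - (a * x + b) / (c * x + d) * c) 0 (q * c) (c * x + d))%g.
Proof.
move=> q0 D D1.
have D' : (a - (a * x + b) / (c * x + d) * c) * (c * x + d) - 0 * (q * c) != 0.
  by rewrite (_ : _ - _ = a * d - b * c) //; field.
by gl_eq; field.
Qed.

Lemma gl_upper a b d : a != 0 -> d != 0 ->
  gl a b 0 d = (scal d * (unip (b / d) * torus (a / d)))%g.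
Proof. by move=> a0 d0; gl_eq; field. Qed.

Lemma cell_1 a b c d : a * d - b * c != 0 -> d != 0 ->
  gl a b c d = (gl ((a * d - b * c) / d) b 0 d * lunip (c / d))%g.
Proof. by move=> D d0; gl_eq; field. Qed.

Lemma cell_lunip a b c d q : a * d - b * c != 0 -> d != 0 -> c != 0 -> q != 0 ->
  let u := c / d / q in
  gl a b c d = (gl ((a * d - b * c) / d / u) b 0 d * lunip q * torus u)%g.
Proof.
move=> D d0 c0 q0 u; have u0 : u != 0 by rewrite /u !mulf_neq0 ?invr_eq0.
gl_eq; last first.
  rewrite mulrDl [b * q * d]mulrAC -[b * d * q]mulrA addrK.
  by rewrite mulf_neq0 // mulf_neq0 ?invr_eq0 // mulf_neq0 ?invr_eq0.
all: by rewrite /u; field; rewrite ?d0 ?c0 ?q0.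
Qed.

Lemma cell_weyl a b c d : a * d - b * c != 0 -> c != 0 ->
  gl a b c d = (gl ((a * d - b * c) / c) a 0 c * weyl F * unip (d / c))%g.
Proof. by move=> D c0; gl_eq; [field..| rewrite mulf_neq0 ?invr_eq0]. Qed.

End Identities.

(** * The double cosets of the Borel subgroup and K_0(p^2) *)

Section Cosets.
Variables (p : nat) (F : fieldType) (O : set F).
Hypothesis pv : p_valued p O.
Local Notation U := (units O).
Local Notation P := (ideal p O).
Local Notation G := (GL2 F).
Implicit Types (a b c d x y : F) (g k : G).

Definition K0 (r : nat) : set G :=
  [set k : G | ((forall i j, O (val k i j)) /\ U (\det (val k))) /\
           P r (val k 1 0)].

Lemma K0_gl r a b c d :
  O a -> O b -> O d -> P r c -> U (a * d - b * c) -> K0 r (gl a b c d).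
Proof.
move=> Oa Ob Od Pc UD; have D := units_neq0 UD; have e := gl_entries D.
split; last by rewrite e.
split; last by rewrite det_gl.
move=> i j; rewrite val_gl // !mxE; case: ifP => _; case: ifP => _ //.
exact: (ideal_integer pv Pc).
Qed.

Lemma K0_lower_unit r k : (0 < r)%N -> K0 r k -> U (val k 1 1) /\ U (val k 0 0).
Proof.
move=> r0 [[Ok UD] Pc]; have P1 := ideal_leq pv r0 Pc.
have UD' : U (val k 0 0 * val k 1 1).
  rewrite -[X in U X](subrK (val k 0 1 * val k 1 0)) -det_mx22.
  by exact: (unitsD pv UD (idealMr pv (Ok _ _) P1)).
have H x y : O x -> O y -> U (x * y) -> U x.
  move=> Ox Oy /(unitsP pv)[_ nP]; apply/(unitsP pv); split=> // Px; apply: nP.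
  exact: idealMl.
by split; [move: UD'; rewrite mulrC|move: UD'] => /H; apply.
Qed.

Lemma K0_unip r x : O x -> K0 r (unip x).
Proof.
move=> Ox; apply: K0_gl => //; try exact: (integers1 pv); first exact: (ideal0 pv).
by rewrite mulr0 subr0 mul1r; exact: (units1 pv).
Qed.

Lemma K0_torus r u : U u -> K0 r (torus u).
Proof.
move=> Uu; apply: K0_gl; try exact: (integers0 pv); try exact: (integers1 pv).
- exact: units_int.
- exact: (ideal0 pv).
by rewrite mulr0 subr0 mulr1.
Qed.

Lemma K0_lunip r c : P r c -> K0 r (lunip c).
Proof.
move=> Pc; apply: K0_gl => //; try exact: (integers1 pv); first exact: (integers0 pv).
by rewrite mul0r subr0 mul1r; exact: (units1 pv).
Qed.

Lemma unip11 x : val (unip x) 1 1 = 1.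
Proof. by rewrite gl_entries // mulr0 subr0 mul1r oner_neq0. Qed.
Lemma lunip11 x : val (lunip x) 1 1 = 1.
Proof. by rewrite gl_entries // mul0r subr0 mul1r oner_neq0. Qed.
Lemma torus11 (u : F) : u != 0 -> val (torus u) 1 1 = 1.
Proof. by move=> u0; rewrite gl_entries // mulr0 subr0 mulr1. Qed.

(** The double coset of g depends on its bottom row (c, d) only, through the
    valuation of c / d: at least 2, exactly 1, or at most 0.  In each case the
    right factor can be chosen with lower right entry 1, so that it acts trivially
    on a newvector. *)
Lemma GL2_cells g : exists a b d k, [/\ a != 0, d != 0, K0 2 k &
  val k 1 1 = 1 /\
  [\/ g = (gl a b 0 d * k)%g, g = (gl a b 0 d * lunip p%:R * k)%g |
      g = (gl a b 0 d * weyl F * k)%g]].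
Proof.
have D := GL2_det g; have := gl_eta g.
move: (val g 0 0) (val g 0 1) (val g 1 0) (val g 1 1) D => a b c d D ->.
case: (pselect (d != 0 /\ P 1 (c / d))) => [[d0 P1]|H].
  case: (pselect (P 2 (c / d))) => [P2|P2].
    exists ((a * d - b * c) / d), b, d, (lunip (c / d)).
    split=> //; [by rewrite mulf_neq0 ?invr_eq0|exact: K0_lunip|].
    by split; [exact: lunip11|apply: Or31; exact: cell_1].
  have p0 := pv_p_neq0 pv.
  have [z Oz] := P1; rewrite expr1 => cz.
  have Uz : U z.
    apply/(unitsP pv); split=> // - [t Ot tz]; apply: P2.
    by exists t => //; rewrite cz tz mulrA.
  have uE : c / d / p%:R = z by rewrite cz mulrAC mulfV ?mul1r.
  have z0 := units_neq0 Uz.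
  have c0 : c != 0 by apply: contra z0 => /eqP c0; rewrite -uE c0 !mul0r.
  exists ((a * d - b * c) / d / z), b, d, (torus z).
  split=> //; [by rewrite !mulf_neq0 ?invr_eq0|exact: K0_torus|].
  by split; [exact: torus11|apply: Or32; rewrite -uE; exact: cell_lunip].
have [|c0 Odc] := ratio_or_inverse pv _ H.
  rewrite -negb_and; apply: contra D => /andP[/eqP -> /eqP ->].
  by rewrite !mulr0 subrr.
exists ((a * d - b * c) / c), a, c, (unip (d / c)).
split=> //; [by rewrite mulf_neq0 ?invr_eq0|exact: K0_unip|].
by split; [exact: unip11|apply: Or33; exact: cell_weyl].
Qed.

End Cosets.

(** * The additive character and the central character *)

Section Characters.
Variables (p : nat) (F : fieldType) (O : set F).
Hypothesis pv : p_valued p O.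
Variable C : numClosedFieldType.
Local Notation U := (units O).
Local Notation P := (ideal p O).
Let p_neq0 := pv_p_neq0 pv.

Variable psi : F -> C.

Record unramified_psi : Prop := UnramifiedPsi {
  psiD : forall x y, psi (x + y) = psi x * psi y;
  psi_int : forall x, O x -> psi x = 1;
  psi_nontriv : exists2 x, O x & psi (x / p%:R) != 1
}.

Hypothesis hpsi : unramified_psi.

Lemma psi0 : psi 0 = 1. Proof. by apply: psi_int => //; exact: (integers0 pv). Qed.

Lemma psi_natM n x : psi (n%:R * x) = psi x ^+ n.
Proof.
elim: n => [|n IH]; first by rewrite mul0r psi0.
by rewrite -natr1 mulrDl mul1r psiD // IH exprSr.
Qed.

Lemma psiN x : psi (- x) * psi x = 1.
Proof. by rewrite -psiD // addNr psi0. Qed.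

(** The values of psi are roots of unity of order a power of p. *)
Lemma norm_psi x : `|psi x| = 1.
Proof.
have [n Pn] : exists n, O (p%:R ^+ n * x).
  have [->|x0] := eqVneq x 0.
    by exists 0%N; rewrite mulr0; exact: (integers0 pv).
  have [[n|n] Un] := pv_val pv x0.
    exists 0%N; rewrite mul1r; rewrite -[x](@divfK _ (p%:R ^ n)) ?expf_neq0 //.
    apply: (integersM pv); first exact: units_int.
    exact/(integersX pv)/(integers_nat pv).
  exists n.+1; have := units_int Un.
  by rewrite -[_ ^ Negz n]/(_ ^- n.+1) invrK mulrC.
have pn : (0 < p ^ n)%N by rewrite expn_gt0 prime_gt0 // (pv_prime pv).
apply: (@pexpIrn _ (p ^ n)) => //; rewrite ?nnegrE ?normr_ge0 ?ler01 //.
by rewrite -normrX -psi_natM natrX psi_int // normr1 expr1n.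
Qed.

(** O is its own dual lattice with respect to psi. *)
Lemma psi_dual y : (forall x, O x -> psi (y * x) = 1) -> O y.
Proof.
move=> H; apply: contrapT => Oy.
have y0 : y != 0 by apply/eqP => y0; apply: Oy; rewrite y0; exact: (integers0 pv).
have [//|Py] := integer_or_inverse pv y0.
have [x Ox] := psi_nontriv hpsi; apply/negP; rewrite negbK; apply/eqP.
have -> : x / p%:R = y * (y^-1 / p%:R * x) by rewrite !mulrA mulfV // mul1r mulrC.
apply: H; apply: (integersM pv) => //.
by move/(idealP pv): Py; rewrite expr1.
Qed.

Lemma psi_pinv_prim : p.-primitive_root (psi p%:R^-1).
Proof.
have pp := pv_prime pv.
have zp : psi p%:R^-1 ^+ p = 1.
  by rewrite -psi_natM mulfV // psi_int //; exact: (integers1 pv).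
have z1 : psi p%:R^-1 != 1.
  have [x Ox] := psi_nontriv hpsi; apply: contra => /eqP z1.
  have [m _ [z Oz]] := pv_residue pv Ox; rewrite expr1 => xm.
  rewrite -[x](subrK m%:R) xm mulrDl mulrAC mulfV // mul1r psiD //.
  by rewrite psi_int // mul1r psi_natM z1 expr1n.
have [k zk kp] := prim_order_exists (prime_gt0 pp) zp.
have /primeP[_ /(_ k kp)/orP[/eqP k1|/eqP ek]] := pp.
  by move: z1; rewrite -(prim_expr_order zk) k1 expr1 eqxx.
by rewrite -[X in X.-primitive_root _]ek.
Qed.

Variable omega : F -> C.

(** A unitary character of conductor exactly p^2. *)
Record ramified_omega : Prop := RamifiedOmega {
  omegaM : forall x y, x != 0 -> y != 0 -> omega (x * y) = omega x * omega y;
  norm_omega : forall x, x != 0 -> `|omega x| = 1;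
  omega_conductor : forall x, P 2 x -> omega (1 + x) = 1;
  omega_ramified : exists2 x, P 1 x & omega (1 + x) != 1
}.

Hypothesis hom : ramified_omega.

Lemma omega1 : omega 1 = 1.
Proof. by rewrite -[1]addr0 (omega_conductor hom) //; exact: (ideal0 pv). Qed.

Lemma unit_1p x : O x -> U (1 + p%:R * x).
Proof. by move=> Ox; apply: (unitsD pv (units1 pv)); exact: ideal_p. Qed.

(** Since 1 + pO modulo 1 + p^2 O is isomorphic to O / pO, the restriction of omega
    becomes an additive character. *)
Definition chi1p x := omega (1 + p%:R * x).

Lemma omega_cong x y : U x -> P 2 y -> omega (x + y) = omega x.
Proof.
move=> Ux Py; have x0 := units_neq0 Ux.
have -> : x + y = x * (1 + y / x) by rewrite mulrDr mulr1 mulrC divfK.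
have Pyx : P 2 (y / x) by apply: (idealMl pv) => //; case: Ux => _ [].
rewrite (omegaM hom) // ?(omega_conductor hom) ?mulr1 //.
by apply/units_neq0/(unitsD pv (units1 pv)); exact: (ideal_leq pv _ Pyx).
Qed.

Lemma chi1pD x y : O x -> O y -> chi1p (x + y) = chi1p x * chi1p y.
Proof.
move=> Ox Oy; rewrite /chi1p -(omegaM hom) ?(units_neq0 (unit_1p _)) //.
have -> : (1 + p%:R * x) * (1 + p%:R * y) =
          (1 + p%:R * (x + y)) + p%:R ^+ 2 * (x * y) by ring.
have Pxy : P 2 (p%:R ^+ 2 * (x * y)) by apply: ideal_exp; exact: (integersM pv).
by rewrite (omega_cong (unit_1p (integersD pv Ox Oy)) Pxy).
Qed.

Lemma chi1p_ideal x : P 1 x -> chi1p x = 1.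
Proof.
move=> [y Oy ->]; rewrite /chi1p (omega_conductor hom) //.
by rewrite expr1 mulrA; exists y.
Qed.

Lemma chi1p_nat n : chi1p n%:R = chi1p 1 ^+ n.
Proof.
elim: n => [|n IH]; first by rewrite chi1p_ideal //; exact: (ideal0 pv).
by rewrite -natr1 chi1pD ?IH ?exprSr //; [exact: (integers_nat pv)|exact: (integers1 pv)].
Qed.

Lemma chi1p_residue x m : O x -> P 1 (x - m%:R) -> chi1p x = chi1p 1 ^+ m.
Proof.
move=> Ox Pxm; rewrite -[x](subrK m%:R).
rewrite (chi1pD (ideal_integer pv Pxm) (integers_nat pv m)).
by rewrite (chi1p_ideal Pxm) mul1r chi1p_nat.
Qed.

Lemma chi1p1_neq1 : chi1p 1 != 1.
Proof.
have [x [y Oy ->]] := omega_ramified hom; apply: contra => /eqP c1.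
have [m _ Pym] := pv_residue pv Oy.
by rewrite expr1 -/(chi1p y) (chi1p_residue Oy Pym) c1 expr1n.
Qed.

Lemma chi1p_neq0 x : O x -> chi1p x != 0.
Proof.
by move=> /unit_1p/units_neq0/(norm_omega hom) n1; rewrite -normr_eq0 n1 oner_neq0.
Qed.

Lemma chi1p_expp : chi1p 1 ^+ p = 1.
Proof.
rewrite -chi1p_nat chi1p_ideal // -[p%:R]mulr1; apply: ideal_p.
exact: (integers1 pv).
Qed.

Lemma chi1pN x : O x -> chi1p (- x) * chi1p x = 1.
Proof.
move=> Ox; rewrite -chi1pD ?addNr ?chi1p_ideal //; first exact: (ideal0 pv).
exact: (integersN pv).
Qed.

(** The characters of O / pO are the x |-> psi(jx / p), because psi(1 / p) is a
    primitive p-th root of unity; the one attached to omega is nontrivial, whence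
    j is a unit. *)
Lemma matching_frequency : exists2 j, (0 < j < p)%N &
  forall n, psi (j%:R / p%:R * n%:R) * chi1p n%:R = 1.
Proof.
have zp : (chi1p 1)^-1 ^+ p = 1 by rewrite exprVn chi1p_expp invr1.
have [[j jp] /= je] := prim_rootP psi_pinv_prim zp; exists j.
  rewrite jp andbT lt0n; apply/negP => /eqP j0; move: je; rewrite j0 expr0 => /eqP.
  by rewrite invr_eq1 (negbTE chi1p1_neq1).
move=> n; have -> : j%:R / p%:R * n%:R = (j * n)%:R * p%:R^-1 :> F.
  by rewrite natrM mulrAC.
rewrite psi_natM exprM -je exprVn chi1p_nat mulVf // expf_neq0 //.
exact: chi1p_neq0 (integers1 pv).
Qed.

End Characters.

(** * The Whittaker newvector *)

Lemma norm_sum_single (C : numClosedFieldType) (I : finType) (Q : pred I)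
    (f : I -> C) (b : C) :
  0 <= b -> (forall i, Q i -> `|f i| <= b) ->
  (forall i j, Q i -> Q j -> f i != 0 -> f j != 0 -> i = j) ->
  `|\sum_(i | Q i) f i| <= b.
Proof.
move=> b0 fb uniq_f.
have [/existsP[i /andP[Qi fi]]|H] := boolP [exists i, Q i && (f i != 0)].
  rewrite (bigD1 i) //= big1 ?addr0 ?fb // => j /andP[Qj ji].
  apply: contraNeq ji => fj; apply/eqP; exact: uniq_f.
rewrite big1 ?normr0 // => i Qi; apply/eqP; apply: contraNT H => fi.
by apply/existsP; exists i; rewrite Qi.
Qed.

Section Whittaker.
Variables (p : nat) (F : fieldType) (O : set F).
Hypothesis pv : p_valued p O.
Variable C : numClosedFieldType.
Variables (psi omega : F -> C).
Hypotheses (hpsi : unramified_psi p O psi) (hom : ramified_omega p O omega).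
Local Notation U := (units O).
Local Notation P := (ideal p O).
Local Notation G := (GL2 F).
Local Notation chi := (chi1p p omega).
Implicit Types (a b d t x y z u : F) (g k : G).
Let p_neq0 := pv_p_neq0 pv.
Let p_gt0 : (0 < p)%N := prime_gt0 (pv_prime pv).

Variables (w : G -> C) (c : C).
Hypothesis wN : forall x g, w (unip x * g)%g = psi x * w g.
Hypothesis wZ : forall z g, z != 0 -> w (scal z * g)%g = omega z * w g.
Hypothesis wK : forall k g, K0 p O 2 k -> w (g * k)%g = omega (val k 1 1) * w g.
Hypothesis wU : forall g,
  \sum_(x < p) w (g * (unip x%:R * torus p%:R))%g = c * w g.
Hypothesis norm_c : `|c| = sqrtC p%:R.

Local Notation s := (sqrtC (p%:R : C)).
Local Notation B := `|w (1%g : G)|.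

Lemma sqrtp_gt0 : 0 < s. Proof. by rewrite sqrtC_gt0 ltr0n. Qed.
Lemma sqrtp_ge1 : 1 <= s.
Proof.
have p1 : 1 <= p%:R :> C by rewrite ler1n.
by rewrite -{1}(sqrtC1 C) ler_sqrtC ?qualifE /= ?ler0n ?ler01.
Qed.

Lemma w_upper a b d g : a != 0 -> d != 0 ->
  `|w (gl a b 0 d * g)%g| = `|w (torus (a / d) * g)%g|.
Proof.
move=> a0 d0; rewrite (gl_upper _ a0 d0) -!mulgA wZ // wN !normrM.
by rewrite (norm_omega hom) // (norm_psi pv hpsi) !mul1r.
Qed.

(** Right invariance under n(O) becomes invariance under psi(yx) on the left. *)
Lemma w_torus_int y : y != 0 -> w (torus y) != 0 -> O y.
Proof.
move=> y0 wy; apply: (psi_dual pv hpsi) => x Ox; apply: (mulIf wy).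
rewrite -wN -torus_unip // wK; last exact: (K0_unip pv).
by rewrite unip11 (omega1 pv hom).
Qed.

Lemma w_torus_unit u g : U u -> w (g * torus u)%g = w g.
Proof.
move=> Uu; rewrite wK; last exact: (K0_torus pv).
by rewrite torus11 ?(omega1 pv hom) ?mul1r //; exact: units_neq0 Uu.
Qed.

Lemma torus_unip_torus y x : y != 0 ->
  (torus y * (unip x * torus p%:R))%g = (unip (y * x) * torus (y * p%:R))%g.
Proof. by move=> y0; rewrite mulgA torus_unip // -mulgA torusM. Qed.

(** For integral y the p terms of the eigenvector equation at a(y) coincide. *)
Lemma w_torus_step y : y != 0 -> O y -> c * w (torus y) = p%:R * w (torus (y * p%:R)).
Proof.
move=> y0 Oy; rewrite -wU.
under eq_bigr => x _.
  rewrite torus_unip_torus // wN (psi_int hpsi) ?mul1r; last first.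
    by apply: (integersM pv) => //; exact: (integers_nat pv).
  over.
by rewrite sumr_const card_ord mulr_natl.
Qed.

Lemma norm_w_torus y : y != 0 -> `|w (torus y)| <= B.
Proof.
move=> y0; have [->|wy] := eqVneq (w (torus y)) 0; first by rewrite normr0.
have [n [u [Uu ->]]] := integer_factor pv (w_torus_int y0 wy) y0.
have u0 := units_neq0 Uu; elim: n => [|n IH].
  by rewrite mul1r -[torus u]mul1g w_torus_unit.
rewrite exprS -mulrA mulrC; set z := p%:R ^+ n * u.
have z0 : z != 0 by rewrite mulf_neq0 // expf_neq0.
have Oz : O z.
  by apply: (integersM pv); [exact/(integersX pv)/(integers_nat pv)|exact: units_int].
have e : s * `|w (torus z)| = s * (s * `|w (torus (z * p%:R))|).
  rewrite mulrA -expr2 sqrtCK -[X in X * _ = _]norm_c -normrM w_torus_step //.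
  by rewrite normrM normr_nat.
apply: le_trans IH; rewrite (mulfI (lt0r_neq0 sqrtp_gt0) e).
by rewrite ler_peMl ?sqrtp_ge1.
Qed.

Lemma K0_conj t x : O t -> O x ->
  K0 p O 2 (gl (1 - p%:R * t * x) (- t * x ^+ 2) (p%:R ^+ 2 * t) (1 + p%:R * t * x)).
Proof.
move=> Ot Ox; have Op := integers_nat pv p.
have Optx : O (p%:R * t * x) by do 2?apply: (integersM pv) => //.
apply: (K0_gl pv).
- by apply: (integersB pv) => //; exact: (integers1 pv).
- by apply: (integersM pv); [exact: (integersN pv)|exact: (integersX pv)].
- by apply: (integersD pv) => //; exact: (integers1 pv).
- exact: ideal_exp.
rewrite (_ : _ - _ = 1); last by ring.
exact: (units1 pv).
Qed.

Lemma gl11_conj t x : val (gl (1 - p%:R * t * x) (- t * x ^+ 2) (p%:R ^+ 2 * t)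
  (1 + p%:R * t * x)) 1 1 = 1 + p%:R * (t * x) :> F.
Proof.
rewrite gl_entries ?mulrA //.
by rewrite (_ : _ - _ = 1) ?oner_neq0 //; ring.
Qed.

(** The two sides are W(n(yx) a(y) n'(p)), computed by the Whittaker property on the
    left and by the newvector property on the right. *)
Lemma w_lunip_inv y x : y != 0 -> O x ->
  psi (y * x) * w (torus y * lunip p%:R)%g = chi (- x) * w (torus y * lunip p%:R)%g.
Proof.
move=> y0 Ox; rewrite -wN mulgA -torus_unip // -mulgA unip_lunip mulgA.
have D : (1 + p%:R * x) * (1 - p%:R * x) - x * (- p%:R ^+ 2 * x) != 0.
  by rewrite (_ : _ - _ = 1) ?oner_neq0 //; ring.
rewrite [LHS]wK; first by rewrite gl_entries // /chi1p mulrN.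
have Opx : O (p%:R * x) by apply: (integersM pv) => //; exact: (integers_nat pv).
apply: (K0_gl pv) => //.
- by apply: (integersD pv) => //; exact: (integers1 pv).
- by apply: (integersB pv) => //; exact: (integers1 pv).
- by exists (- x); rewrite ?mulNr ?mulrN //; exact: (integersN pv).
rewrite (_ : _ - _ = 1); last by ring.
exact: (units1 pv).
Qed.

Lemma w_lunip_step y : y != 0 ->
  c * w (torus y * lunip p%:R)%g =
  (\sum_(x < p) psi (y * x%:R) * chi x%:R) * w (torus (y * p%:R)).
Proof.
move=> y0; rewrite -wU mulr_suml; apply: eq_bigr => x _.
have Ox := integers_nat pv x; have O1 := integers1 pv.
rewrite -mulgA -[X in lunip X]mulr1 lunip_unip_torus // !mulgA -[(torus y * _ * _)%g]mulgA.
rewrite torus_unip_torus // wK; last exact: K0_conj.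
by rewrite gl11_conj mul1r wN mulrA [omega _ * _]mulrC.
Qed.

(** By duality, y p is integral since psi(yx) depends on x modulo p only, and it is
    a unit since omega is nontrivial on 1 + pO. *)
Lemma w_lunip_neq0 y : y != 0 -> w (torus y * lunip p%:R)%g != 0 ->
  (forall x, O x -> psi (y * x) * chi x = 1) /\ U (y * p%:R).
Proof.
move=> y0 wy.
have psichi x : O x -> psi (y * x) * chi x = 1.
  move=> Ox; have := w_lunip_inv y0 Ox => /(mulIf wy) ->.
  by rewrite (chi1pN pv hom).
split=> //; apply/(unitsP pv); split.
  apply: (psi_dual pv hpsi) => x Ox; have Opx := ideal_p p Ox.
  rewrite -mulrA -[RHS](psichi (p%:R * x)); last exact: (ideal_integer pv Opx).
  by rewrite (chi1p_ideal hom Opx) mulr1.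
move=> /(idealP pv); rewrite expr1 mulfK // => Oy.
have := psichi 1 (integers1 pv); rewrite mulr1 (psi_int hpsi) // mul1r.
by apply/eqP; exact: (chi1p1_neq1 pv hom).
Qed.

Lemma norm_w_lunip_match y : y != 0 -> U (y * p%:R) ->
  (forall n, psi (y * n%:R) * chi n%:R = 1) ->
  `|w (torus y * lunip p%:R)%g| = s * B.
Proof.
move=> y0 Uy psichi; apply: (mulfI (lt0r_neq0 sqrtp_gt0)).
rewrite -{1}norm_c -normrM w_lunip_step //.
under eq_bigr => x _ do rewrite psichi.
rewrite sumr_const card_ord normrM normr_nat.
by rewrite -[torus _]mul1g w_torus_unit // mulrA -expr2 sqrtCK.
Qed.

Lemma norm_w_lunip y : y != 0 -> w (torus y * lunip p%:R)%g != 0 ->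
  `|w (torus y * lunip p%:R)%g| = s * B.
Proof.
move=> y0 /(w_lunip_neq0 y0)[psichi Uy]; apply: norm_w_lunip_match => // n.
exact/psichi/(integers_nat pv).
Qed.

Lemma norm_w_lunip_le y : y != 0 -> `|w (torus y * lunip p%:R)%g| <= s * B.
Proof.
move=> y0; have [->|/(norm_w_lunip y0)-> //] := eqVneq (w (torus y * lunip p%:R)%g) 0.
by rewrite normr0 mulr_ge0 // ltW // sqrtp_gt0.
Qed.

(** The maximum is reached at y = j / p, for the frequency j that matches omega. *)
Lemma w_lunip_attained : exists g, `|w g| = s * B.
Proof.
have [j jp psichi] := matching_frequency pv hpsi hom.
have Uj := units_nat pv jp; have j0 := units_neq0 Uj.
have y0 : j%:R / p%:R != 0 :> F by rewrite mulf_neq0 ?invr_eq0.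
exists (torus (j%:R / p%:R) * lunip p%:R)%g.
by apply: norm_w_lunip_match => //; rewrite divfK.
Qed.

Lemma w_weyl_int y : y != 0 -> w (torus y * weyl F)%g != 0 -> O (y * p%:R ^+ 2).
Proof.
move=> y0 wy; apply: (psi_dual pv hpsi) => x Ox; apply: (mulIf wy).
rewrite -mulrA mul1r -wN mulgA -torus_unip // -mulgA unip_weyl mulgA [LHS]wK.
  by rewrite lunip11 (omega1 pv hom) mul1r.
by apply: (K0_lunip pv); apply: (idealN pv); exact: ideal_exp.
Qed.

Lemma unit_ord (x : 'I_p) : x != Ordinal p_gt0 -> U x%:R.
Proof.
move=> xn0; apply: (units_nat pv); rewrite ltn_ord andbT lt0n.
by apply: contra xn0 => /eqP x0; apply/eqP/val_inj.
Qed.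

(** In the eigenvector equation at a(y) w0, the term x = 0 stays in the big cell
    and the others move to the middle cell. *)
Lemma w_weyl_step y : y != 0 ->
  c * w (torus y * weyl F)%g = omega p%:R * w (torus (y / p%:R) * weyl F)%g +
  \sum_(x < p | x != Ordinal p_gt0)
    omega x%:R * psi (- (y / x%:R)) * w (torus (y * p%:R / x%:R) * lunip p%:R)%g.
Proof.
move=> y0; rewrite -wU (bigD1 (Ordinal p_gt0)) //=; congr (_ + _).
  have -> : unip (0 : F) = 1%g by rewrite gl1.
  rewrite mul1g -mulgA weyl_torus // mulgA scalC // -mulgA wZ //.
  by rewrite mulgA torusM // invr_eq0.
apply: eq_bigr => x xn0.
have Ux := unit_ord xn0; have x0 := units_neq0 Ux.
rewrite -mulgA weyl_unip_torus // mulgA scalC // -mulgA wZ // mulgA torus_unip //.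
rewrite -mulgA wN mulgA torusM ?mulf_neq0 ?invr_eq0 // mulgA.
rewrite w_torus_unit; last exact: unitsV.
by rewrite mulrN !mulrA.
Qed.

(** Both y / i and y / j match the same character of O / pO, so that y / i - y / j is
    integral, whereas y p / i is a unit. *)
Lemma w_lunip_uniq y (i j : 'I_p) : y != 0 ->
  i != Ordinal p_gt0 -> j != Ordinal p_gt0 ->
  w (torus (y / i%:R) * lunip p%:R)%g != 0 ->
  w (torus (y / j%:R) * lunip p%:R)%g != 0 -> i = j.
Proof.
move=> y0 /unit_ord Ui /unit_ord Uj.
have [i0 j0] := (units_neq0 Ui, units_neq0 Uj).
have yi0 : y / i%:R != 0 by rewrite mulf_neq0 ?invr_eq0.
have yj0 : y / j%:R != 0 by rewrite mulf_neq0 ?invr_eq0.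
move=> /(w_lunip_neq0 yi0)[psii Uyi] /(w_lunip_neq0 yj0)[psij _].
have Oij : O (y / i%:R - y / j%:R).
  apply: (psi_dual pv hpsi) => x Ox; have cx := chi1p_neq0 pv hom Ox.
  have e : psi (y / i%:R * x) = psi (y / j%:R * x).
    by apply: (mulIf cx); rewrite psii // psij.
  by rewrite mulrBl (psiD hpsi) e mulrC (psiN pv hpsi).
apply/val_inj/(residue_inj pv) => //=; rewrite -opprB; apply: (idealN pv).
have -> : j%:R - i%:R = p%:R * (y / i%:R - y / j%:R) * ((y / i%:R * p%:R)^-1 * j%:R).
  by field; rewrite i0 j0 y0 p_neq0.
apply: (idealMl pv); first exact: ideal_p.
by apply: (integersM pv); [exact: (units_int (unitsV Uyi))|exact: units_int].
Qed.

(** Induction on the valuation of y, starting at -2, the bottom of the support.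
    There the term in y / p vanishes and at most one term of the sum survives;
    above it, the sum vanishes and H(y) = omega(p) H(y / p) / c. *)
Lemma norm_w_weyl y : y != 0 -> `|w (torus y * weyl F)%g| <= B.
Proof.
have p20 : p%:R ^+ 2 != 0 :> F by rewrite expf_neq0.
move=> y0; have [->|wy] := eqVneq (w (torus y * weyl F)%g) 0; first by rewrite normr0.
have yp0 : y * p%:R ^+ 2 != 0 by rewrite mulf_neq0.
have [n [u [Uu yu]]] := integer_factor pv (w_weyl_int y0 wy) yp0.
have {y0 wy yp0 yu}-> : y = p%:R ^+ n * u / p%:R ^+ 2 by rewrite -yu mulfK.
have u0 := units_neq0 Uu; elim: n => [|n IH].
  rewrite mul1r; have y0 : u / p%:R ^+ 2 != 0 by rewrite mulf_neq0 ?invr_eq0.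
  rewrite -(ler_pM2l sqrtp_gt0) -[X in X * _ <= _]norm_c -normrM w_weyl_step //.
  have -> : w (torus (u / p%:R ^+ 2 / p%:R) * weyl F)%g = 0.
    apply/eqP/negPn/negP => /w_weyl_int; rewrite mulf_neq0 ?invr_eq0 //.
    move=> /(_ isT); rewrite mulrAC divfK // => Oup.
    by apply: (units_ideal pv Uu); apply/(idealP pv); rewrite expr1.
  rewrite mulr0 add0r; apply: norm_sum_single => [|i i0|i j i0 j0].
  - by rewrite mulr_ge0 // ltW // sqrtp_gt0.
  - have Ui := units_neq0 (unit_ord i0).
    rewrite !normrM (norm_omega hom) // (norm_psi pv hpsi) !mul1r.
    by apply: norm_w_lunip_le; rewrite !mulf_neq0 ?invr_eq0.
  rewrite !mulf_eq0 !negb_or => /andP[_ wi] /andP[_ wj].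
  by apply: w_lunip_uniq wi wj => //; rewrite mulf_neq0.
have y0 : p%:R ^+ n.+1 * u / p%:R ^+ 2 != 0.
  by rewrite !mulf_neq0 ?invr_eq0 // expf_neq0.
apply: le_trans IH; rewrite -(ler_pM2l sqrtp_gt0) -[X in X * _ <= _]norm_c -normrM.
rewrite w_weyl_step // big1 ?addr0 => [|i i0].
  rewrite normrM (norm_omega hom) // mul1r.
  have -> : p%:R ^+ n.+1 * u / p%:R ^+ 2 / p%:R = p%:R ^+ n * u / p%:R ^+ 2 :> F.
    by rewrite exprS; field.
  by rewrite ler_peMl ?sqrtp_ge1.
have Ui := unit_ord i0; have ni0 := units_neq0 Ui.
have yi0 : p%:R ^+ n.+1 * u / p%:R ^+ 2 * p%:R / i%:R != 0.
  by rewrite mulf_neq0 ?invr_eq0 // mulf_neq0.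
apply/eqP; rewrite mulf_eq0; apply/orP; right; apply/negPn/negP.
move=> /(w_lunip_neq0 yi0)[_ Up].
apply: (units_ideal pv (unitsM pv Up Ui)).
have -> : p%:R ^+ n.+1 * u / p%:R ^+ 2 * p%:R / i%:R * p%:R * i%:R =
          p%:R * (p%:R ^+ n * u) by rewrite exprS; field; rewrite ni0 p_neq0.
apply: ideal_p; apply: (integersM pv); last exact: units_int.
exact/(integersX pv)/(integers_nat pv).
Qed.

Theorem whittaker_newform_sup :
  (forall g, `|w g| <= s * B) /\ (exists g, `|w g| = s * B).
Proof.
split; last exact: w_lunip_attained.
have Bs : B <= s * B by rewrite ler_peMl ?sqrtp_ge1.
move=> g; have [a [b [d [k [a0 d0 Kk [k11 cells]]]]]] := GL2_cells pv g.
have ad0 : a / d != 0 by rewrite mulf_neq0 ?invr_eq0.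
case: cells => ->; rewrite wK // k11 (omega1 pv hom) mul1r.
- by rewrite -[gl _ _ _ _]mulg1 w_upper // mulg1 (le_trans _ Bs) // norm_w_torus.
- by rewrite w_upper // norm_w_lunip_le.
- by rewrite w_upper // (le_trans _ Bs) // norm_w_weyl.
Qed.

End Whittaker.

(** * Newvectors in a unitary representation *)

Section Newvectors.
Variables (p : nat) (F : fieldType) (O : set F).
Hypothesis pv : p_valued p O.
Variable C : numClosedFieldType.
Variables (pi : representation (GL2 F) C) (omega : F -> C).
Local Notation U := (units O).
Local Notation P := (ideal p O).
Local Notation G := (GL2 F).
Local Notation chi := (chi1p p omega).
Implicit Types (a b t x y z u : F) (g k : G) (v : pi).
Let p_neq0 := pv_p_neq0 pv.

Definition newvector (r : nat) v : Prop :=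
  forall k, K0 p O r k -> rep_act k v = omega (val k 1 1) *: v.

Hypothesis central : forall z v, z != 0 -> rep_act (scal z) v = omega z *: v.
Variable v : pi.
Hypotheses (v0 : v != 0) (new_v : newvector 2 v).

Lemma scale_inj (a b : C) : a *: v = b *: v -> a = b.
Proof.
move=> /eqP; rewrite -subr_eq0 -scalerBl scaler_eq0 (negbTE v0) orbF subr_eq0.
by move/eqP.
Qed.

Lemma centralM x y : x != 0 -> y != 0 -> omega (x * y) = omega x * omega y.
Proof.
move=> x0 y0; apply: scale_inj; rewrite -central ?mulf_neq0 //.
have -> : scal (x * y) = (scal x * scal y)%g by gl_eq; ring.
by rewrite rep_actM !central // scalerA.
Qed.

Lemma central1 : omega 1 = 1.
Proof.
apply: scale_inj; rewrite -central ?oner_neq0 //.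
by rewrite (_ : scal 1 = 1%g) ?gl1 // -gl1 rep_act1 scale1r.
Qed.

(** The scalar omega(delta) is multiplicative on K_0(p^2), and the product of n'(x)
    and n(1) has lower right entry 1 + x. *)
Lemma newvector_conductor x : P 2 x -> omega (1 + x) = 1.
Proof.
move=> Px; apply: scale_inj; rewrite scale1r.
have Ox := ideal_integer pv Px; have O1 := integers1 pv.
have e : (lunip x * unip 1)%g = gl 1 1 x (1 + x) by gl_eq; ring.
have D : 1 * (1 + x) - 1 * x = 1 by ring.
have Kg : K0 p O 2 (gl 1 1 x (1 + x)).
  apply: (K0_gl pv) => //; first exact: (integersD pv).
  by rewrite D; exact: (units1 pv).
have := new_v Kg; rewrite gl_entries ?D ?oner_neq0 // => <-.
rewrite -e rep_actM new_v; last exact: (K0_unip pv).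
rewrite unip11 central1 scale1r new_v; last exact: (K0_lunip pv).
by rewrite lunip11 central1 scale1r.
Qed.

Variable form : pi -> pi -> C.
Hypothesis form_lin : forall (c : C) (u u' w : pi),
  form (c *: u + u') w = c * form u w + form u' w.
Hypothesis form_conj : forall u w : pi, form w u = (form u w)^*%R.
Hypothesis form_pos : forall u : pi, u != 0 -> 0 < form u u.
Hypothesis form_inv : forall g (u w : pi),
  form (rep_act g u) (rep_act g w) = form u w.

Lemma form0l (w : pi) : form 0 w = 0.
Proof.
have := form_lin 1 0 0 w; rewrite scaler0 add0r mul1r => /eqP.
by rewrite -subr_eq0 opprD addNKr oppr_eq0 => /eqP.
Qed.
Lemma formDl (u u' w : pi) : form (u + u') w = form u w + form u' w.
Proof. by rewrite -[u]scale1r form_lin mul1r scale1r. Qed.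
Lemma formZl (c : C) (u w : pi) : form (c *: u) w = c * form u w.
Proof. by rewrite -[c *: u]addr0 form_lin form0l addr0. Qed.
Lemma formZr (c : C) (u w : pi) : form u (c *: w) = c^*%R * form u w.
Proof. by rewrite form_conj formZl rmorphM /= -form_conj. Qed.
Lemma form_suml n (f : 'I_n -> pi) (w : pi) :
  form (\sum_i f i) w = \sum_i form (f i) w.
Proof.
by apply: (big_morph (form^~ w)); [move=> u u'; exact: formDl|exact: form0l].
Qed.
Lemma form_sumr n (f : 'I_n -> pi) (u : pi) :
  form u (\sum_i f i) = \sum_i form u (f i).
Proof.
rewrite form_conj form_suml rmorph_sum /=.
by apply: eq_bigr => i _; rewrite -form_conj.
Qed.

Lemma central_norm z : z != 0 -> `|omega z| = 1.
Proof.
move=> z0; have := form_inv (scal z) v v; rewrite central // formZl formZr mulrA.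
rewrite -normCK -[X in _ = X]mul1r => /(mulIf (lt0r_neq0 (form_pos v0))) n2.
by apply: (@pexpIrn _ 2) => //; rewrite ?nnegrE ?normr_ge0 ?ler01 // expr1n.
Qed.

Hypothesis hom : ramified_omega p O omega.

Definition shift t : pi := rep_act (unip t * torus p%:R)%g v.
(** This is the Hecke operator U_p applied to v. *)
Definition Up : pi := \sum_(x < p) shift x%:R.

Lemma shift_cong x y : P 1 (x - y) -> shift x = shift y.
Proof.
move=> [t Ot]; rewrite expr1 => xy.
have -> : x = y + p%:R * t by rewrite -xy addrC subrK.
rewrite /shift unipD_torus // rep_actM new_v; last exact: (K0_unip pv).
by rewrite unip11 central1 scale1r.
Qed.

(** The summand at x only depends on x modulo p, and k in K_0(p^2) permutes the
    summands by a homography, which is injective modulo p; the remaining factor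
    acts by omega(cx + d) = omega(d). *)
Lemma Up_newvector : newvector 2 Up.
Proof.
move=> k Kk; have [[Ok UD] Pc] := Kk; have D := GL2_det k.
have [Ud _] := K0_lower_unit pv (isT : 0 < 2)%N Kk.
have kE := gl_eta k; rewrite det_mx22 in UD.
move: (val k 0 0) (val k 0 1) (val k 1 0) (val k 1 1) (Ok 0 0) (Ok 0 1) (Ok 1 1)
  kE UD D Ud Pc => a b c d Oa Ob Od kE UD D Ud Pc.
have Uden (x : 'I_p) : U (c * x%:R + d).
  rewrite addrC; apply: (unitsD pv Ud).
  exact: (idealMl pv (ideal_leq pv (isT : 1 <= 2)%N Pc) (integers_nat pv x)).
pose x' (x : 'I_p) := (a * x%:R + b) / (c * x%:R + d).
have Ox' (x : 'I_p) : O (x' x).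
  apply: (integersM pv); last exact: (units_int (unitsV (Uden x))).
  by apply: (integersD pv) => //; apply: (integersM pv) => //; exact: (integers_nat pv).
have [|m mP] := @boolp.choice _ _ (fun x m : 'I_p => P 1 (x' x - m%:R)).
  by move=> x; have [n np Pn] := pv_residue pv (Ox' x); exists (Ordinal np).
have m_inj : injective m.
  move=> x y mxy; apply/val_inj/(residue_inj pv) => //=.
  have Pxy : P 1 (x' x - x' y).
    have -> : x' x - x' y = (x' x - (m x)%:R) - (x' y - (m y)%:R).
      by rewrite mxy; ring.
    exact: (idealB pv).
  have [Ux Uy] := (Uden x, Uden y); have [x0 y0] := (units_neq0 Ux, units_neq0 Uy).
  have -> : x%:R - y%:R = (x' x - x' y) *
      ((c * x%:R + d) * (c * y%:R + d) * (a * d - b * c)^-1).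
    by rewrite /x'; field; rewrite x0 y0 D.
  apply: (idealMl pv Pxy); apply: (integersM pv); last exact: (units_int (unitsV UD)).
  by apply: (integersM pv); exact: units_int.
rewrite /Up linear_sum scaler_sumr [RHS](reindex_inj m_inj) /=; apply: eq_bigr => x _.
rewrite -(shift_cong (mP x)) /shift -rep_actM {1}kE.
have dx0 := units_neq0 (Uden x).
rewrite gl_unip_torus // rep_actM -/(x' x).
have D' : (a - x' x * c) * (c * x%:R + d) - 0 * (p%:R * c) = a * d - b * c.
  by rewrite /x'; field.
rewrite new_v; last first.
  apply: (K0_gl pv); rewrite ?D' //; try exact: units_int.
  - by apply: (integersB pv) => //; apply: (integersM pv) => //; exact: (ideal_integer pv Pc).
  - exact: (integers0 pv).
  - by apply: (idealMr pv) => //; exact: (integers_nat pv).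
rewrite linearZ /= gl_entries ?D' // addrC (omega_cong pv hom) //.
exact: (idealMl pv Pc (integers_nat pv x)).
Qed.

Lemma shift_eigen t x : O t -> O x ->
  rep_act (lunip (p%:R * t)) (shift x) = chi (t * x) *: shift x.
Proof.
move=> Ot Ox; rewrite /shift -rep_actM lunip_unip_torus // rep_actM new_v.
  by rewrite gl11_conj linearZ.
exact: K0_conj.
Qed.

(** For t = 1 / (x - y), the eigenvalues of n'(pt) at the two vectors differ by the
    factor omega(1 + p), which is not 1. *)
Lemma shift_orthogonal (x y : 'I_p) :
  x != y -> form (shift x%:R) (shift y%:R) = 0.
Proof.
move=> xy; have [Ox Oy] := (integers_nat pv x, integers_nat pv y).
have Uxy : U (x%:R - y%:R).
  apply/(unitsP pv); split; first exact: (integersB pv).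
  by move=> /(residue_inj pv (ltn_ord x) (ltn_ord y))/val_inj/eqP; apply/negP.
have xy0 := units_neq0 Uxy; set t := (x%:R - y%:R : F)^-1.
have Ot : O t := units_int (unitsV Uxy).
have Oty : O (t * y%:R) by exact: (integersM pv).
have e : t * x%:R = 1 + t * y%:R by rewrite /t; field.
have := form_inv (lunip (p%:R * t)) (shift x%:R) (shift y%:R).
rewrite !shift_eigen // formZl formZr e (chi1pD pv hom (integers1 pv) Oty).
rewrite mulrA -[_ * _ * _^*]mulrA -normCK (norm_omega hom); last first.
  exact: (units_neq0 (unit_1p pv Oty)).
rewrite expr1n mulr1 => /eqP; rewrite -subr_eq0 -[X in _ - X]mul1r -mulrBl mulf_eq0.
by rewrite subr_eq0 (negbTE (chi1p1_neq1 pv hom)) => /eqP.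
Qed.

(** By orthogonality the squared norm of U_p v is p times that of v. *)
Lemma Up_eigenvalue_norm c : Up = c *: v -> `|c| = sqrtC p%:R.
Proof.
move=> Uc; have fv := lt0r_neq0 (form_pos v0).
have : form Up Up = p%:R * form v v.
  rewrite {1}/Up form_suml; under eq_bigr => x _.
    rewrite /Up form_sumr (bigD1 x) //= big1 ?addr0; last first.
      by move=> y yx; rewrite shift_orthogonal // eq_sym.
    rewrite form_inv; over.
  by rewrite sumr_const card_ord mulr_natl.
rewrite Uc formZl formZr mulrA -normCK => /(mulIf fv) n2.
by rewrite -n2 sqrCK.
Qed.

End Newvectors.

(** * Newvectors in the induced model *)

Section Induced.
Variables (p : nat) (F : fieldType) (O : set F).
Hypothesis pv : p_valued p O.
Variable C : numClosedFieldType.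
Local Notation U := (units O).
Local Notation P := (ideal p O).
Local Notation G := (GL2 F).
Implicit Types (a b c d t x y z u : F) (g k : G).
Let p_neq0 := pv_p_neq0 pv.

Definition mult_char (chi : F -> C) : Prop :=
  forall x y, x != 0 -> y != 0 -> chi (x * y) = chi x * chi y.

(* delta stands for the square root of the absolute value *)
Variables (chi1 chi2 delta : F -> C).
Hypotheses (chi1M : mult_char chi1) (chi2M : mult_char chi2).
Hypotheses (chi1_neq0 : forall x, x != 0 -> chi1 x != 0).
Hypotheses (chi2_neq0 : forall x, x != 0 -> chi2 x != 0).
Hypothesis deltaM : mult_char delta.
Hypothesis delta_unit : forall u, U u -> delta u = 1.

Lemma mult1 (chi : F -> C) :
  mult_char chi -> (forall x, x != 0 -> chi x != 0) -> chi 1 = 1.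
Proof.
move=> chiM /(_ 1 (oner_neq0 _)) chi0; apply: (mulIf chi0).
by rewrite -chiM ?oner_neq0 // !mul1r.
Qed.

Let chi11 := mult1 chi1M chi1_neq0.
Let chi21 := mult1 chi2M chi2_neq0.

Definition borel_equivariant (f : G -> C) : Prop :=
  forall a b d g, a != 0 -> d != 0 ->
    f (gl a b 0 d * g)%g = chi1 a * chi2 d * delta (a / d) * f g.

Section NewSpace.
Variable omega : F -> C.
Hypothesis hom : ramified_omega p O omega.
Hypothesis omegaE : forall x, x != 0 -> omega x = chi1 x * chi2 x.
Variable f : G -> C.
Hypothesis fB : borel_equivariant f.
Hypothesis fK : forall k g, K0 p O 2 k -> f (g * k)%g = omega (val k 1 1) * f g.

(** The relation n(1) n'(p) = n'(p) k multiplies this value by omega(1 - p). *)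
Lemma newspace_lunip : f (lunip p%:R) = 0.
Proof.
have O1 := integers1 pv; have Op := integers_nat pv p.
have D : (1 + p%:R) * (1 - p%:R) - 1 * - p%:R ^+ 2 = 1 :> F by ring.
have := unip_lunip (p%:R : F) 1; rewrite !mulr1 => /(congr1 f).
rewrite fB ?oner_neq0 // divr1 chi11 chi21 (delta_unit (units1 pv)) !mul1r.
rewrite fK; last first.
  apply: (K0_gl pv) => //; first exact: (integersD pv).
  - exact: (integersB pv).
  - by exists (- 1); rewrite ?mulrN1 //; exact: (integersN pv).
  - by rewrite D; exact: (units1 pv).
rewrite gl_entries ?D ?oner_neq0 // => /eqP.
have c1 : omega (1 - p%:R) != 1.
  apply: contra (chi1p1_neq1 pv hom) => /eqP c1.
  by rewrite -(chi1pN pv hom O1) /chi1p mulrN1 c1 mul1r.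
rewrite -subr_eq0 -[X in X - _]mul1r -mulrBl mulf_eq0 subr_eq0 eq_sym.
by rewrite (negbTE c1) => /eqP.
Qed.

Let a1 : U (1 + p%:R * 1). Proof. exact: (unit_1p pv (integers1 pv)). Qed.

(** With d = 1 + p, the matrix diag(1, d) acts on w0 from the left by chi2(d), which
    is omega(d) and not 1; moved to the right it becomes diag(d, 1), which acts
    trivially. *)
Lemma newspace_weyl : (forall u, U u -> chi1 u = 1) -> f (weyl F) = 0.
Proof.
move=> unr; have a0 := units_neq0 a1; move: (a1) (a0); set d := 1 + _ => Ud d0.
have e : (gl 1 0 0 d * weyl F)%g = (weyl F * torus d)%g by gl_eq; ring.
have := congr1 f e; rewrite fB ?oner_neq0 // fK; last exact: (K0_torus pv).
rewrite torus11 // (omega1 pv hom) chi11 (delta_unit (unitsM pv (units1 pv) (unitsV Ud))).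
rewrite mulr1 => /eqP; rewrite -subr_eq0 -mulrBl mulf_eq0 mul1r subr_eq0.
have -> : chi2 d = omega d by rewrite omegaE // unr // mul1r.
by rewrite (negbTE (chi1p1_neq1 pv hom)) => /eqP.
Qed.

(** The same comparison for diag(a, 1) with a = 1 + p, which commutes with 1. *)
Lemma newspace_1 : (forall u, U u -> chi2 u = 1) -> f 1%g = 0.
Proof.
move=> unr; have a0 := units_neq0 a1; move: (a1) (a0); set a := 1 + _ => Ua a0'.
have e : (torus a * 1)%g = (1 * torus a)%g by rewrite mulg1 mul1g.
have := congr1 f e; rewrite [LHS]fB ?oner_neq0 // [RHS]fK; last exact: (K0_torus pv).
rewrite torus11 // (omega1 pv hom) chi21 divr1 (delta_unit Ua).
rewrite !mulr1 => /eqP; rewrite -subr_eq0 -mulrBl mulf_eq0 subr_eq0.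
have -> : chi1 a = omega a by rewrite omegaE // unr // mulr1.
by rewrite (negbTE (chi1p1_neq1 pv hom)) => /eqP.
Qed.

Lemma newspace_vanish : f 1%g = 0 -> f (weyl F) = 0 -> forall g, f g = 0.
Proof.
move=> f1 fw g; have [a [b [d [k [a0 d0 Kk [_ cells]]]]]] := GL2_cells pv g.
case: cells => ->; rewrite fK //.
- by rewrite -[gl _ _ _ _]mulg1 fB // f1 !mulr0.
- by rewrite fB // newspace_lunip !mulr0.
- by rewrite fB // fw !mulr0.
Qed.

End NewSpace.

Section LevelP.

Lemma val_mul1 g h (j : 'I_2) :
  val (g * h)%g 1 j = val g 1 0 * val h 0 j + val g 1 1 * val h 1 j.
Proof.
rewrite /= mxE !big_ord_recl big_ord0 addr0.
by congr (val g _ _ * val h _ _ + val g _ _ * val h _ _); apply: val_inj.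
Qed.

Lemma det_mul g h : \det (val (g * h)%g) = \det (val g) * \det (val h).
Proof. exact: det_mulmx. Qed.

Lemma det_neq0 g : \det (val g) != 0.
Proof. by rewrite -unitfE -unitmxE GL2_unit. Qed.

(** The small cell is B K_0(p), and the large cell is its complement B w0 K_0(p). *)
Definition small_cell g := val g 1 1 != 0 /\ P 1 (val g 1 0 / val g 1 1).
Definition large_cell g := val g 1 0 != 0 /\ O (val g 1 1 / val g 1 0).

Lemma small_or_large g : ~ small_cell g -> large_cell g.
Proof.
apply: (ratio_or_inverse pv); rewrite -negb_and.
apply: contra (det_neq0 g) => /andP[/eqP c0 /eqP d0].
by rewrite det_mx22 c0 d0 !mulr0 subrr.
Qed.

Lemma small_not_large g : small_cell g -> ~ large_cell g.
Proof.
move=> [d0 Pcd] [c0 Odc]; apply: (units_ideal pv (units1 pv)).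
have -> : 1 = val g 1 0 / val g 1 1 * (val g 1 1 / val g 1 0) by field; rewrite c0.
exact: (idealMl pv).
Qed.

Lemma small_cell_mulK0 g k : K0 p O 1 k -> small_cell g ->
  small_cell (g * k)%g /\ exists u, [/\ U u, P 1 (u / val k 1 1 - 1) &
     val (g * k)%g 1 1 = val g 1 1 * u].
Proof.
move=> Kk [d0 Pcd]; have [[Ok UD] Pc] := Kk.
have [Ud Ua] := K0_lower_unit pv (isT : 0 < 1)%N Kk.
have k110 := units_neq0 Ud.
set e := val g 1 0 / val g 1 1 * val k 0 1.
have Pe : P 1 e by exact: (idealMl pv).
have Uu : U (val k 1 1 + e) by exact: (unitsD pv).
have u0 := units_neq0 Uu.
have dE : val (g * k)%g 1 1 = val g 1 1 * (val k 1 1 + e).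
  by rewrite val_mul1 /e; field.
split; last first.
  exists (val k 1 1 + e); split=> //; rewrite mulrDl mulfV // addrAC subrr add0r.
  by apply: (idealMl pv Pe); exact: (units_int (unitsV Ud)).
split; first by rewrite dE mulf_neq0.
rewrite dE val_mul1.
have -> : (val g 1 0 * val k 0 0 + val g 1 1 * val k 1 0) /
    (val g 1 1 * (val k 1 1 + e)) =
    (val g 1 0 / val g 1 1 * val k 0 0 + val k 1 0) * (val k 1 1 + e)^-1.
  by field; rewrite d0 u0.
apply: (idealMl pv); last exact: (units_int (unitsV Uu)).
by apply: (idealD pv) => //; exact: (idealMl pv).
Qed.

Lemma large_cell_mulK0 g k : K0 p O 1 k -> large_cell g ->
  large_cell (g * k)%g /\ exists u, [/\ U u, P 1 (u / val k 0 0 - 1) &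
     val (g * k)%g 1 0 = val g 1 0 * u].
Proof.
move=> Kk [c0 Odc]; have [[Ok UD] Pc] := Kk.
have [Ud Ua] := K0_lower_unit pv (isT : 0 < 1)%N Kk.
have k000 := units_neq0 Ua.
set e := val g 1 1 / val g 1 0 * val k 1 0.
have Pe : P 1 e by exact: (idealMr pv).
have Uu : U (val k 0 0 + e) by exact: (unitsD pv).
have u0 := units_neq0 Uu.
have cE : val (g * k)%g 1 0 = val g 1 0 * (val k 0 0 + e).
  by rewrite val_mul1 /e; field.
split; last first.
  exists (val k 0 0 + e); split=> //; rewrite mulrDl mulfV // addrAC subrr add0r.
  by apply: (idealMl pv Pe); exact: (units_int (unitsV Ua)).
split; first by rewrite cE mulf_neq0.
rewrite cE val_mul1.
have -> : (val g 1 0 * val k 0 1 + val g 1 1 * val k 1 1) /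
    (val g 1 0 * (val k 0 0 + e)) =
    (val k 0 1 + val g 1 1 / val g 1 0 * val k 1 1) * (val k 0 0 + e)^-1.
  by field; rewrite c0 u0.
apply: (integersM pv); last exact: (units_int (unitsV Uu)).
by apply: (integersD pv) => //; exact: (integersM pv).
Qed.

Lemma small_cell_borel a b d g : a != 0 -> d != 0 ->
  small_cell (gl a b 0 d * g)%g <-> small_cell g.
Proof.
move=> a0 d0; have D : a * d - b * 0 != 0 by rewrite mulr0 subr0 mulf_neq0.
rewrite /small_cell !val_mul1 !gl_entries // !mul0r !add0r mulf_eq0 negb_or d0 /=.
suff e : d * val g 1 0 / (d * val g 1 1) = val g 1 0 / val g 1 1 by rewrite e.
by rewrite -mulf_div mulfV // mul1r.
Qed.

(** The section of the induced representation that is supported on B K_0(p) and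
    equals 1 at 1: on a matrix with bottom row (c, d) there, the Borel part can be
    taken to be diag(det / d, d).  It is a vector of level p if chi1 is unramified
    and chi2 is trivial on 1 + pO. *)
Definition small_cell_fun g : C :=
  if `[< small_cell g >] then
    chi1 (\det (val g) / val g 1 1) * chi2 (val g 1 1) *
    delta (\det (val g) / val g 1 1 ^+ 2)
  else 0.

(** The analogous section supported on B w0 K_0(p), with Borel part diag(det / c, c),
    for chi2 unramified and chi1 trivial on 1 + pO. *)
Definition large_cell_fun g : C :=
  if `[< small_cell g >] then 0 else
    chi1 (\det (val g) / val g 1 0) * chi2 (val g 1 0) *
    delta (\det (val g) / val g 1 0 ^+ 2).

Lemma borel_value a d D c : a != 0 -> d != 0 -> D != 0 -> c != 0 ->
  chi1 (a * d * D / (d * c)) * chi2 (d * c) * delta (a * d * D / (d * c) ^+ 2) =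
  chi1 a * chi2 d * delta (a / d) *
    (chi1 (D / c) * chi2 c * delta (D / c ^+ 2)).
Proof.
move=> a0 d0 D0 c0.
have -> : a * d * D / (d * c) = a * (D / c) by field; rewrite c0.
have -> : a * d * D / (d * c) ^+ 2 = (a / d) * (D / c ^+ 2) by field; rewrite c0.
rewrite chi1M ?chi2M ?deltaM ?mulf_neq0 ?invr_eq0 ?expf_neq0 //; ring.
Qed.

Lemma small_cell_fun_borel : borel_equivariant small_cell_fun.
Proof.
move=> a b d g a0 d0; have D : a * d - b * 0 != 0 by rewrite mulr0 subr0 mulf_neq0.
rewrite /small_cell_fun; have -> := asbool_equiv_eq (small_cell_borel b g a0 d0).
case: asboolP => [[c0 _]|_]; last by rewrite mulr0.
rewrite det_mul det_gl // val_mul1 !gl_entries // mul0r add0r mulr0 subr0.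
exact: borel_value (det_neq0 g) c0.
Qed.

Lemma large_cell_fun_borel : borel_equivariant large_cell_fun.
Proof.
move=> a b d g a0 d0; have D : a * d - b * 0 != 0 by rewrite mulr0 subr0 mulf_neq0.
rewrite /large_cell_fun; have -> := asbool_equiv_eq (small_cell_borel b g a0 d0).
case: asboolP => [_|/small_or_large[c0 _]]; first by rewrite mulr0.
rewrite det_mul det_gl // val_mul1 !gl_entries // mul0r add0r mulr0 subr0.
exact: borel_value (det_neq0 g) c0.
Qed.

Lemma unit_value D K c u (e : C) : U K -> U u -> D != 0 -> c != 0 ->
  chi1 (K / u) * chi2 u = e ->
  chi1 (D * K / (c * u)) * chi2 (c * u) * delta (D * K / (c * u) ^+ 2) =
  e * (chi1 (D / c) * chi2 c * delta (D / c ^+ 2)).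
Proof.
move=> UK Uu D0 c0 <-; have [K0 u0] := (units_neq0 UK, units_neq0 Uu).
have -> : D * K / (c * u) = (K / u) * (D / c) by field; rewrite u0 c0.
have -> : D * K / (c * u) ^+ 2 = (K / u / u) * (D / c ^+ 2) by field; rewrite u0 c0.
have Uuu : U (K / u / u).
  by apply: (unitsM pv (unitsM pv UK (unitsV Uu))); exact: unitsV.
have Dc0 : D / c ^+ 2 != 0 by rewrite mulf_neq0 ?invr_eq0 ?expf_neq0.
rewrite (deltaM (units_neq0 Uuu) Dc0) (delta_unit Uuu).
by rewrite chi1M ?chi2M ?mulf_neq0 ?invr_eq0 //; ring.
Qed.

Lemma tame_cong (chi : F -> C) x y : mult_char chi ->
  (forall t, P 1 t -> chi (1 + t) = 1) -> U x -> U y -> P 1 (x / y - 1) ->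
  chi x = chi y.
Proof.
move=> chiM tame Ux Uy Pxy; have [x0 y0] := (units_neq0 Ux, units_neq0 Uy).
rewrite -[x](divfK y0) chiM ?mulf_neq0 ?invr_eq0 //.
by rewrite -[x / y](subrK 1) addrC tame ?mul1r.
Qed.

Lemma small_cell_fun_K0 g k :
  (forall u, U u -> chi1 u = 1) -> (forall t, P 1 t -> chi2 (1 + t) = 1) ->
  K0 p O 1 k -> small_cell_fun (g * k)%g = chi2 (val k 1 1) * small_cell_fun g.
Proof.
move=> unr tame Kk; have [[_ UK] _] := Kk.
have [Ud _] := K0_lower_unit pv (isT : 0 < 1)%N Kk.
rewrite /small_cell_fun; case: asboolP => [Sgk|NSgk]; case: asboolP => [Sg|NSg].
- have [_ [u [Uu Pu ->]]] := small_cell_mulK0 Kk Sg.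
  rewrite det_mul; apply: unit_value => //; [exact: det_neq0|by case: Sg|].
  by rewrite unr ?mul1r; [exact: tame_cong|exact: (unitsM pv UK (unitsV Uu))].
- by have [/(small_not_large Sgk)] := large_cell_mulK0 Kk (small_or_large NSg).
- by have [/NSgk] := small_cell_mulK0 Kk Sg.
- by rewrite mulr0.
Qed.

Lemma large_cell_fun_K0 g k :
  (forall u, U u -> chi2 u = 1) -> (forall t, P 1 t -> chi1 (1 + t) = 1) ->
  K0 p O 1 k -> large_cell_fun (g * k)%g = chi1 (val k 1 1) * large_cell_fun g.
Proof.
move=> unr tame Kk; have [[Ok UK] Pc] := Kk.
have [Ud Ua] := K0_lower_unit pv (isT : 0 < 1)%N Kk.
have [d0 a0] := (units_neq0 Ud, units_neq0 Ua).
rewrite /large_cell_fun; case: asboolP => [Sgk|NSgk]; case: asboolP => [Sg|NSg].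
- by rewrite mulr0.
- by have [/(small_not_large Sgk)] := large_cell_mulK0 Kk (small_or_large NSg).
- by have [/NSgk] := small_cell_mulK0 Kk Sg.
have Lg := small_or_large NSg.
have [_ [u [Uu Pu ->]]] := large_cell_mulK0 Kk Lg; have u0 := units_neq0 Uu.
rewrite det_mul; apply: unit_value => //; [exact: det_neq0|by case: Lg|].
rewrite unr // mulr1; apply: tame_cong => //.
  exact: (unitsM pv UK (unitsV Uu)).
(* with k = (alpha, beta; gamma, delta), this is the identity
   det k / (u delta) = (alpha / u) (1 - beta gamma / (alpha delta)) *)
have -> : \det (val k) / u / val k 1 1 - 1 =
  - ((u / val k 0 0 - 1) + val k 0 1 / val k 1 1 / val k 0 0 * val k 1 0) *
    (val k 0 0 / u).
  by rewrite det_mx22; field; rewrite u0 d0 a0.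
apply: (idealMl pv); last exact: (units_int (unitsM pv Ua (unitsV Uu))).
apply/(idealN pv)/(idealD pv) => //; apply: (idealMr pv) => //.
apply: (integersM pv); last exact: (units_int (unitsV Ua)).
by apply: (integersM pv) => //; exact: (units_int (unitsV Ud)).
Qed.

Lemma small_cell_fun_neq0 : small_cell_fun 1%g != 0.
Proof.
have D : 1 * 1 - 0 * 0 != 0 :> F by rewrite mulr0 subr0 mulr1 oner_neq0.
have S1 : small_cell 1%g.
  rewrite gl1; split; rewrite !gl_entries // ?oner_neq0 // mul0r.
  exact: (ideal0 pv).
rewrite /small_cell_fun asboolT // gl1 det_gl // !gl_entries //.
rewrite mulr0 subr0 mulr1 expr1n !divr1 chi11 chi21 (delta_unit (units1 pv)).
by rewrite !mulr1 oner_neq0.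
Qed.

Lemma large_cell_fun_neq0 : large_cell_fun (weyl F) != 0.
Proof.
have D : 0 * 0 - -1 * 1 != 0 :> F by rewrite mulr0 sub0r mulr1 opprK oner_neq0.
have S1 : ~ small_cell (weyl F).
  by case; rewrite gl_entries // eqxx.
rewrite /large_cell_fun asboolF // det_gl // !gl_entries //.
rewrite mulr0 sub0r mulr1 opprK expr1n !divr1 chi11 chi21 (delta_unit (units1 pv)).
by rewrite !mulr1 oner_neq0.
Qed.

End LevelP.

End Induced.

(** * Representations realised on functions *)

Section Realizations.
Variables (G : groupType) (C : numClosedFieldType) (pi : representation G C).
Variable T : pi -> G -> C.
Hypothesis T_lin : forall (c : C) u v x, T (c *: u + v) x = c * T u x + T v x.
Hypothesis T_inj : injective T.

Lemma realization0 x : T 0 x = 0.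
Proof.
have := T_lin 1 0 0 x; rewrite scaler0 add0r mul1r => /eqP.
by rewrite -subr_eq0 opprD addNKr oppr_eq0 => /eqP.
Qed.

Lemma realizationZ c v x : T (c *: v) x = c * T v x.
Proof. by rewrite -[c *: v]addr0 T_lin realization0 addr0. Qed.

Lemma realization_sum n (f : 'I_n -> pi) x : T (\sum_i f i) x = \sum_i T (f i) x.
Proof.
apply: (big_morph (T^~ x)); last exact: realization0.
by move=> u v; rewrite -[u]scale1r T_lin mul1r scale1r.
Qed.

Lemma realization_eq0 v : (forall x, T v x = 0) -> v = 0.
Proof.
by move=> H; apply: T_inj; apply: funext => x; rewrite H realization0.
Qed.

End Realizations.

(** * The maximum of the newvector *)

Section Main.
Variables (p : nat) (F : fieldType) (O : set F).
Hypothesis pv : p_valued p O.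
Variable C : numClosedFieldType.
Local Notation U := (units O).
Local Notation P := (ideal p O).
Local Notation G := (GL2 F).
Let p_neq0 := pv_p_neq0 pv.

Variables (psi omega chi1 chi2 delta : F -> C) (pi : representation G C).
Variables (I W : set (G -> C)) (w : G -> C).
Hypothesis hpsi : unramified_psi p O psi.
Hypotheses (chi1M : mult_char chi1) (chi2M : mult_char chi2).
Hypotheses (chi1_neq0 : forall x, x != 0 -> chi1 x != 0).
Hypotheses (chi2_neq0 : forall x, x != 0 -> chi2 x != 0).
Hypothesis deltaM : mult_char delta.
Hypothesis delta_unit : forall u, U u -> delta u = 1.
Hypothesis minimal :
  (forall u, U u -> chi1 u = 1) \/ (forall u, U u -> chi2 u = 1).

Hypothesis real_I : realized_on pi I.
Hypothesis I_borel : forall f, I f -> borel_equivariant chi1 chi2 delta f.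
Hypothesis I_smooth : forall f, borel_equivariant chi1 chi2 delta f ->
  (forall k g, K0 p O 1 k -> P 1 (val k 1 1 - 1) -> f (g * k)%g = f g) -> I f.

Hypothesis unit_pi : unitary pi.
Hypothesis central : forall z (v : pi), z != 0 -> rep_act (scal z) v = omega z *: v.
Hypothesis no_level_p :
  ~ exists2 v : pi, v != 0 & newvector p O omega 1 v.

Hypothesis real_W : realized_on pi W.
Hypothesis W_psi : forall f, W f -> forall x g, f (unip x * g)%g = psi x * f g.
Hypothesis Ww : W w.
Hypothesis w_neq0 : w <> cst 0.
Hypothesis wK : forall k g, K0 p O 2 k -> w (g * k)%g = omega (val k 1 1) * w g.

(** The induced model I and the Whittaker model W are only used through their
    linear equivariant bijections with pi: the former yields the conductor of omega
    and the eigenvector equation, the latter carries this equation to w. *)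
Theorem twist_minimal_sup :
  (forall g, `|w g| <= sqrtC p%:R * `|w 1%g|) /\
  (exists g, `|w g| = sqrtC p%:R * `|w 1%g|).
Proof.
have [T [T_lin T_inj T_range T_act]] := real_W.
have [v _ vw] : range T w by rewrite T_range.
have v0 : v != 0.
  apply/eqP => v0; apply: w_neq0; apply: funext => x.
  by rewrite -vw v0 (realization0 T_lin).
have new_v : newvector p O omega 2 v.
  move=> k Kk; apply: T_inj; apply: funext => x.
  by rewrite T_act (realizationZ T_lin) vw wK.
have [form [form_lin form_conj form_pos form_inv]] := unit_pi.
have [S [S_lin S_inj S_range S_act]] := real_I.
have S_borel u : borel_equivariant chi1 chi2 delta (S u).
  by apply: I_borel; rewrite -S_range; exists u.
have omegaE z : z != 0 -> omega z = chi1 z * chi2 z.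
  move=> z0; have [g Sg] : exists g, S v g != 0.
    apply: contrapT => /forallNP H; move/eqP: v0; apply.
    apply: (realization_eq0 S_lin S_inj) => x; apply/eqP; apply: contrapT.
    by move=> Sx; apply: (H x); apply/negP.
  apply: (mulIf Sg); rewrite -(realizationZ S_lin) -central // S_act scalC //.
  by rewrite S_borel // mulfV // (delta_unit (units1 pv)) mulr1.
have [chi11 chi21] := (mult1 chi1M chi1_neq0, mult1 chi2M chi2_neq0).
have level_p f : borel_equivariant chi1 chi2 delta f -> (exists g, f g != 0) ->
    (forall x, P 1 x -> omega (1 + x) = 1) ->
    (forall k g, K0 p O 1 k -> f (g * k)%g = omega (val k 1 1) * f g) -> False.
  move=> fB [g fg] tame fK; apply: no_level_p.
  have [u _ uf] : range S f.
    rewrite S_range; apply: I_smooth => // k h Kk Pk.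
    by rewrite fK // -[val k 1 1](subrK 1) addrC tame ?mul1r.
  exists u.
    by apply: contraNneq fg => u0; rewrite -uf u0 (realization0 S_lin).
  move=> k Kk; apply: S_inj; apply: funext => x.
  by rewrite S_act (realizationZ S_lin) uf fK.
have unit11 k : K0 p O 1 k -> U (val k 1 1).
  by move=> /(K0_lower_unit pv (isT : 0 < 1)%N)[].
(* were omega trivial on 1 + pO, there would be a vector of level p *)
have hom : ramified_omega p O omega.
  split.
  - exact: (centralM central v0).
  - exact: (central_norm central v0 form_lin form_conj form_pos form_inv).
  - exact: (newvector_conductor pv central v0 new_v).
  apply: contrapT => H.
  have tame x : P 1 x -> omega (1 + x) = 1.
    move=> Px; apply: contrapT => /eqP ox; apply: H; by exists x.
  case: minimal => unr.
    have tame2 t : P 1 t -> chi2 (1 + t) = 1.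
      move=> Pt; have Ut := unitsD pv (units1 pv) Pt.
      by have := tame t Pt; rewrite omegaE ?(units_neq0 Ut) // unr // mul1r.
    apply: (level_p (small_cell_fun p O chi1 chi2 delta)) => //.
    - exact: small_cell_fun_borel.
    - by exists 1%g; exact: small_cell_fun_neq0.
    move=> k g Kk; have Ud := unit11 k Kk.
    by rewrite small_cell_fun_K0 // omegaE ?(units_neq0 Ud) // unr // mul1r.
  have tame1 t : P 1 t -> chi1 (1 + t) = 1.
    move=> Pt; have Ut := unitsD pv (units1 pv) Pt.
    have := tame t Pt; rewrite omegaE ?(units_neq0 Ut) //.
    by rewrite [chi2 _]unr // mulr1.
  apply: (level_p (large_cell_fun p O chi1 chi2 delta)) => //.
  - exact: large_cell_fun_borel.
  - by exists (weyl F); exact: large_cell_fun_neq0.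
  move=> k g Kk; have Ud := unit11 k Kk.
  rewrite large_cell_fun_K0 // omegaE ?(units_neq0 Ud) //.
  by rewrite [chi2 _]unr // mulr1.
have S_K u : newvector p O omega 2 u ->
    forall k g, K0 p O 2 k -> S u (g * k)%g = omega (val k 1 1) * S u g.
  by move=> new_u k g Kk; rewrite -S_act new_u // (realizationZ S_lin).
(* newvectors are determined by their value at one point g0 of the induced model,
   whence the multiplicity one that makes v an eigenvector of U_p *)
have [g0 Sg0] : exists g0, forall u, newvector p O omega 2 u -> S u g0 = 0 -> u = 0.
  case: minimal => unr; [exists 1%g|exists (weyl F)] => u new_u u0;
      apply: (realization_eq0 S_lin S_inj).
    apply: (newspace_vanish pv chi1M chi2M chi1_neq0 chi2_neq0 delta_unit hom
      (S_borel u) (S_K u new_u) u0).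
    exact: (newspace_weyl pv chi1M chi1_neq0 delta_unit hom omegaE (S_borel u) (S_K u new_u)).
  apply: (newspace_vanish pv chi1M chi2M chi1_neq0 chi2_neq0 delta_unit hom
      (S_borel u) (S_K u new_u) _ u0).
  exact: (newspace_1 pv chi2M chi2_neq0 delta_unit hom omegaE (S_borel u) (S_K u new_u)).
have new_Up := Up_newvector pv central v0 new_v hom.
pose c := S (Up p v) g0 / S v g0.
have Upc : Up p v = c *: v.
  have Sv0 : S v g0 != 0.
    by apply: contraNneq v0 => Sv; apply/eqP/Sg0.
  apply/eqP; rewrite eq_sym -subr_eq0 -oppr_eq0 opprB addrC -scaleNr; apply/eqP/Sg0.
    move=> k Kk; rewrite linearP /= new_v // new_Up // scalerDr !scalerA.
    by rewrite [_ * - c]mulrC.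
  by rewrite S_lin /c mulNr divfK // addNr.
have norm_c := Up_eigenvalue_norm pv v0 new_v form_lin form_conj form_pos form_inv hom Upc.
apply: (whittaker_newform_sup pv hpsi hom) norm_c => //.
- exact: W_psi.
- move=> z g z0; rewrite -scalC // -vw -T_act central // (realizationZ T_lin).
  by [].
- move=> g; have := congr1 (T^~ g) Upc; rewrite (realizationZ T_lin) vw => <-.
  rewrite /Up (realization_sum T_lin); apply: eq_bigr => x _.
  by rewrite T_act vw.
Qed.

End Main.

(** * The p-adic case *)

Section Modulus.
Variables (p : nat) (F : fieldType) (O : set F).
Hypothesis pv : p_valued p O.
Variable R : realType.

Definition modulus (x : F) : R[i] := (Num.sqrt (vnorm p O R x))%:C.

Lemma modulusM : mult_char modulus.
Proof.
move=> x y x0 y0; rewrite /modulus (vnormM pv R x0 y0).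
by rewrite sqrtrM ?vnorm_ge0 // rmorphM.
Qed.

Lemma modulus_unit u : units O u -> modulus u = 1.
Proof. by move=> Uu; rewrite /modulus (vnorm_unit pv R Uu) sqrtr1. Qed.

End Modulus.

Theorem proposition1p4 (R : realType) (p : nat) (p_pr : prime p)
    (psi : padic p_pr -> R[i])
    (pi : representation (GL2 (padic p_pr)) R[i])
    (omega : padic p_pr -> R[i])
    (W : set (GL2 (padic p_pr) -> R[i]))
    (w : GL2 (padic p_pr) -> R[i]) :
  unramified_additive_character psi ->
  twist_minimal_principal_series pi ->
  unitary pi ->
  central_character pi omega ->
  conductor_exponent pi omega 2 ->
  whittaker_model psi pi W ->
  whittaker_newvector omega 2 W w ->
  (forall g, `|w g| <= sqrtC p%:R * `|w 1%g|) /\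
  (exists g, `|w g| = sqrtC p%:R * `|w 1%g|).
Proof.
move=> [psiD psi1 psi_ne] [chi1 [chi2 [[qc1 qc2 _ real_I] min]]] unit_pi central.
move=> [_ cond2] [real_W W_psi] [Ww wn0 wK].
have [[chi1_neq0 chi1M _] [chi2_neq0 chi2M _]] := (qc1, qc2).
have pv := padic_p_valued p_pr.
apply: (twist_minimal_sup pv (UnramifiedPsi psiD psi1 psi_ne) chi1M chi2M
  chi1_neq0 chi2_neq0 (modulusM pv R) (modulus_unit pv R) min real_I
  _ _ unit_pi _ _ real_W _ Ww wn0 wK).
- move=> f [fB _] a b d g a0 d0; rewrite -(upperE b a0 d0); exact: fB.
- move=> f fB f_sm; split.
    by move=> a b d a0 d0 g; rewrite upperE; exact: fB.
  exists 1%N => k g [Kk Pk]; apply: f_sm; last exact: (Pk 1 1).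
  split; first exact: Kk.
  by have := Pk 1 0; rewrite subr0.
- move=> z v z0; rewrite -(central z z0) /homothety upperE; reflexivity.
- move=> [v v0 new_v]; have : (2 <= 1)%N; last by [].
  by apply: cond2; exists v => //; exact: new_v.
- by move=> f Wf x g; rewrite -W_psi // /unipotent upperE.
Qed.
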